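(* Let $\mathcal{M}$ be the set of all real $4\times 4$ matrices $P=(p_{ij})$ whose entries are nonnegative and sum to $1$ and whose rank is at most two. For $P\in\mathcal{M}$ let $$L(P)=\prod_{i=1}^4 p_{ii}^4 \times \prod_{i\neq j} p_{ij}^2,$$ where the second product is over all ordered pairs $(i,j)$ with $1\le i,j\le 4$, $i\ne j$. Then the matrix $$P^*=\frac{1}{40}\begin{pmatrix} 3&3&2&2\\ 3&3&2&2\\ 2&2&3&3\\ 2&2&3&3\end{pmatrix}\in\mathcal{M}$$ is a global maximum of $L$ on $\mathcal{M}$, i.e. $L(P)\le L(P^* )$ for all $P\in\mathcal{M}$. *)

(* Defs.v *)
From mathcomp Require Import all_boot all_order all_algebra.
From mathcomp Require Import classical_sets reals.

Set Implicit Arguments.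
Unset Strict Implicit.
Unset Printing Implicit Defensive.

Import Order.TTheory GRing.Theory Num.Theory.
Local Open Scope ring_scope.
Local Open Scope classical_set_scope.

Definition rank2_model (R : realType) : set 'M[R]_4 :=
  [set P : 'M[R]_4 | [/\ forall i j, 0 <= P i j,
                      \sum_i \sum_j P i j = 1
                    & (\rank P <= 2)%N]].

Definition likelihood (R : realType) (P : 'M[R]_4) : R :=
  (\prod_i P i i ^+ 4) * (\prod_i \prod_(j | j != i) P i j ^+ 2).

Definition Pstar (R : realType) : 'M[R]_4 :=
  40%:R^-1 *: \matrix_(i, j)
    (nth [::] [:: [:: 3; 3; 2; 2];
                  [:: 3; 3; 2; 2];
                  [:: 2; 2; 3; 3];
                  [:: 2; 2; 3; 3]] i)`_j.

(* Main.v *)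
From Stdlib Require Import ZArith.
Require Import Defs.
From mathcomp Require Import all_boot all_order all_algebra.
From mathcomp Require Import classical_sets reals.
From mathcomp Require Import perm boolp topology normedtype derive.
From mathcomp Require Import zify ssrZ ring lra.
Set Implicit Arguments.
Unset Strict Implicit.
Unset Printing Implicit Defensive.
Import Order.TTheory GRing.Theory Num.Theory.
Import numFieldNormedType.Exports.
Local Open Scope classical_set_scope.
Local Open Scope ring_scope.
Delimit Scope Z_scope with BZ.

(** Scaling the rows, then the columns, of a rank two matrix to equal sums does not
decrease L, by AM-GM, so at a maximum both families of sums are uniform.  A maximum exists
because a row-uniform matrix of rank two has all its rows on one segment of the simplex,
which gives a compact parametrisation.  At a maximum therefore 16 p_ij = 1 + a_i b_j with
sum a = sum b = 0, and L(P) = F^2 / 16^40 with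
F = prod_i (1 + a_i b_i) * prod_(i,j) (1 + a_i b_j); moreover a_i b_i >= 0, and a and b are
ordered alike.  It remains to show F <= (6/5)^12 (4/5)^8, according to signs.

Signs (+,+,-,-).  Write a = x (1+D, 1-D, -1+D', -1-D'), b = y (1+E, 1-E, -1+E', -1-E'),
t = xy, s = tDE, s' = tD'E'.  Pairing factors bounds sqrt F (1-t)^4 by
K(s) K(s') (1 - 2ss'), with K = [damped t] a polynomial, and K(0) = (1+t)^3 (1-t)^4.
If 4/25 <= t <= 1/3 then K(s) <= K(0); if t <= 4/25 the factor 1 - 2ss' compensates a slight
excess of K near s = t; if t >= 1/3 cruder bounds suffice.

Signs (+,-,-,-) and (+,+,+,-).  Two applications of AM-GM separate a from b, and leave a
symmetric function of three numbers w_i of sum 3, a polynomial in t and in the elementary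
symmetric functions of the w_i, which Schur's inequality relates.

The polynomial inequalities in two variables that remain are strict, and are checked by
computing lower bounds on small squares. *)

(** * Positivity of polynomials on the unit square *)

Section ListPoly.
Variables (R : realFieldType) (C : Type) (cadd cmul : C -> C -> C) (c0 : C).
Variables (phi : C -> R) (lbC : C -> Z).

(** The coefficient type is abstract, with interpretation [phi] and lower bound [lbC], so that the
    construction nests: lists of lists serve as polynomials in two variables. *)
Fixpoint padd (l m : seq C) : seq C :=
  match l, m with
  | [::], _ => m
  | _, [::] => l
  | a :: l', b :: m' => cadd a b :: padd l' m'
  end.

Fixpoint pmul (l m : seq C) : seq C :=
  if l is a :: l' then padd [seq cmul a b | b <- m] (c0 :: pmul l' m) else [::].

Definition peval (x : R) (l : seq C) : R := foldr (fun c acc => phi c + x * acc) 0 l.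

(* Horner's scheme with every variable replaced by an unknown of [0, 1] *)
Definition plb (l : seq C) : Z := foldr (fun c acc => Z.add (lbC c) (Z.min Z0 acc)) Z0 l.

Hypotheses (phi0 : phi c0 = 0) (phiD : {morph phi : a b / cadd a b >-> a + b})
           (phiM : {morph phi : a b / cmul a b >-> a * b}).

Lemma pevalD x : {morph peval x : l m / padd l m >-> l + m}.
Proof.
elim=> [|a l IH] [|b m] /=; rewrite ?add0r ?addr0 //.
by rewrite IH phiD; ring.
Qed.

Lemma pevalM x : {morph peval x : l m / pmul l m >-> l * m}.
Proof.
elim=> [|a l IH] m /=; first by rewrite mul0r.
rewrite pevalD /= IH phi0 mulrDl add0r mulrA; congr (_ + _).
elim: m => [|b m IHm] /=; first by rewrite mulr0.
by rewrite IHm phiM; ring.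
Qed.

Definition ZtoR (z : Z) : R := (int_of_Z z)%:~R.

Lemma ZtoRD : {morph ZtoR : a b / (a + b)%BZ >-> a + b}.
Proof. by move=> a b; rewrite /ZtoR -intrD; congr (_%:~R); lia. Qed.

Lemma ZtoRM : {morph ZtoR : a b / (a * b)%BZ >-> a * b}.
Proof. by move=> a b; rewrite /ZtoR -intrM; congr (_%:~R); lia. Qed.

Lemma ler_ZtoR a b : (a <= b)%BZ -> ZtoR a <= ZtoR b.
Proof. by move=> ab; rewrite /ZtoR ler_int; lia. Qed.

Hypothesis lbCP : forall c, ZtoR (lbC c) <= phi c.

Lemma plbP x l : 0 <= x <= 1 -> ZtoR (plb l) <= peval x l.
Proof.
move=> /andP[x0 x1]; elim: l => [|c l IH] //=.
rewrite ZtoRD lerD //.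
have le0 : ZtoR (Z.min Z0 (plb l)) <= ZtoR Z0 by apply: ler_ZtoR; lia.
have Z00 : ZtoR Z0 = 0 by [].
have le1 : ZtoR (Z.min Z0 (plb l)) <= peval x l.
  by apply: le_trans IH; apply: ler_ZtoR; lia.
by rewrite Z00 in le0; nra.
Qed.

End ListPoly.

(** * Homogeneous expressions and their certification by subdivision *)

Inductive hexpr :=
  | HO | HX | HY | HC of Z
  | HAdd of hexpr & hexpr | HSub of hexpr & hexpr | HMul of hexpr & hexpr
  | HPow of hexpr & nat.

Fixpoint hdeg (e : hexpr) : nat :=
  match e with
  | HC _ => 0
  | HAdd e1 _ | HSub e1 _ => hdeg e1
  | HMul e1 e2 => hdeg e1 + hdeg e2
  | HPow e1 n => n * hdeg e1
  | _ => 1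
  end.

Fixpoint homogeneous (e : hexpr) : bool :=
  match e with
  | HAdd e1 e2 | HSub e1 e2 => [&& homogeneous e1, homogeneous e2 & hdeg e1 == hdeg e2]
  | HMul e1 e2 => homogeneous e1 && homogeneous e2
  | HPow e1 _ => homogeneous e1
  | _ => true
  end.

Fixpoint heval (R : realFieldType) (o x y : R) (e : hexpr) : R :=
  match e with
  | HO => o | HX => x | HY => y | HC c => ZtoR R c
  | HAdd e1 e2 => heval o x y e1 + heval o x y e2
  | HSub e1 e2 => heval o x y e1 - heval o x y e2
  | HMul e1 e2 => heval o x y e1 * heval o x y e2
  | HPow e1 n => heval o x y e1 ^+ n
  end.

(** Homogeneity clears denominators: the sign at a rational point is read off at an integer multiple
    of it, so all computations stay in [Z]. *)
Lemma heval_homogeneous (R : realFieldType) (k o x y : R) e : homogeneous e ->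
  heval (k * o) (k * x) (k * y) e = k ^+ hdeg e * heval o x y e.
Proof.
elim: e => [||| c |e1 I1 e2 I2|e1 I1 e2 I2|e1 I1 e2 I2|e1 I1 n] /=; rewrite ?expr1 ?mul1r //.
- by move=> /and3P[/I1 -> /I2 -> /eqP ->]; rewrite mulrDr.
- by move=> /and3P[/I1 -> /I2 -> /eqP ->]; rewrite mulrBr.
- by move=> /andP[/I1 -> /I2 ->]; rewrite exprD; ring.
- by move=> /I1 ->; rewrite exprMn -exprM mulnC.
Qed.

Definition p2add := padd (padd Z.add).
Definition p2mul := pmul (padd Z.add) (pmul Z.add Z.mul Z0) [::].
Arguments p2add : simpl never.
Arguments p2mul : simpl never.
Definition p2eval (R : realFieldType) (x y : R) := peval (peval (@ZtoR R) y) x.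
Definition p2lb := plb (plb id).

Section Expand.
Variables N i j : Z.

(** The Taylor shift to the corner [(i, j)], with [HO] set to [N]. The outer list is in powers of
    the first variable, the inner ones in powers of the second; on the cell both shifted variables
    run over [0, 1], as [plb] requires. *)
Fixpoint expand (e : hexpr) : seq (seq Z) :=
  match e with
  | HO => [:: [:: N]]
  | HX => [:: [:: i]; [:: 1%BZ]]
  | HY => [:: [:: j; 1%BZ]]
  | HC c => [:: [:: c]]
  | HAdd e1 e2 => p2add (expand e1) (expand e2)
  | HSub e1 e2 => p2add (expand e1) (p2mul [:: [:: (-1)%BZ]] (expand e2))
  | HMul e1 e2 => p2mul (expand e1) (expand e2)
  | HPow e1 n => iter n (p2mul (expand e1)) [:: [:: 1%BZ]]
  end.

Lemma expandE (R : realFieldType) (x y : R) e :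
  p2eval x y (expand e) = heval (ZtoR R N) (ZtoR R i + x) (ZtoR R j + y) e.
Proof.
have evD : {morph p2eval x y : l m / p2add l m >-> l + m}.
  by apply: pevalD; apply: pevalD; apply: ZtoRD.
have evM : {morph p2eval x y : l m / p2mul l m >-> l * m}.
  apply: pevalM => //; first by apply: pevalD; apply: ZtoRD.
  by apply: pevalM => //; [apply: ZtoRD | apply: ZtoRM].
have Z1 : ZtoR R 1%BZ = 1 by [].
have ZN1 : ZtoR R (-1)%BZ = -1 by [].
elim: e => [||| c |e1 I1 e2 I2|e1 I1 e2 I2|e1 I1 e2 I2|e1 I1 n] /=.
- by rewrite /p2eval /=; ring.
- by rewrite /p2eval /= Z1; ring.
- by rewrite /p2eval /= Z1; ring.
- by rewrite /p2eval /=; ring.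
- by rewrite evD I1 I2.
- rewrite evD evM I1 I2; congr (_ + _).
  by rewrite /p2eval /= ZN1; ring.
- by rewrite evM I1 I2.
- rewrite -I1; elim: n => [|n IH]; first by rewrite /p2eval /= Z1; ring.
  by rewrite iterS evM IH exprS.
Qed.

End Expand.

(* [X / N, Y / N] range over the cell [i/N, (i+1)/N] x [j/N, (j+1)/N],
   which is split into four when the lower bound is inconclusive. *)
Fixpoint cell_nonneg (e : hexpr) (d : nat) (N i j : Z) : bool :=
  if (Z0 <=? p2lb (expand N i j e))%BZ then true else
  if d is d'.+1 then
    let i' := (2 * i)%BZ in let j' := (2 * j)%BZ in let N' := (2 * N)%BZ in
    [&& cell_nonneg e d' N' i' j', cell_nonneg e d' N' (i' + 1)%BZ j',
        cell_nonneg e d' N' i' (j' + 1)%BZ & cell_nonneg e d' N' (i' + 1)%BZ (j' + 1)%BZ]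
  else false.

Lemma cell_nonnegP (R : realFieldType) e d N i j : homogeneous e ->
  cell_nonneg e d N i j -> forall X Y : R,
  ZtoR R i <= X <= ZtoR R i + 1 -> ZtoR R j <= Y <= ZtoR R j + 1 ->
  0 <= heval (ZtoR R N) X Y e.
Proof.
move=> he; have leaf N' i' j' (X Y : R) :
    (Z0 <=? p2lb (expand N' i' j' e))%BZ ->
    ZtoR R i' <= X <= ZtoR R i' + 1 -> ZtoR R j' <= Y <= ZtoR R j' + 1 ->
    0 <= heval (ZtoR R N') X Y e.
  move=> lb0 /andP[X0 X1] /andP[Y0 Y1].
  have := expandE N' i' j' (X - ZtoR R i') (Y - ZtoR R j') e.
  rewrite ![_ + (_ - _)]addrC !subrK => <-.
  apply: (@le_trans _ _ (ZtoR R (p2lb (expand N' i' j' e)))).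
    by rewrite -[0]/(ZtoR R 0%BZ); apply: ler_ZtoR; lia.
  apply: plbP; last by apply/andP; split; lra.
  by move=> c; apply: plbP => //; apply/andP; split; lra.
elim: d N i j => [|d IH] N i j /=.
  by case: ifP => // H _ X Y; apply: leaf.
have two z : ZtoR R (2 * z)%BZ = 2 * ZtoR R z by rewrite ZtoRM.
have twoS z : ZtoR R (2 * z + 1)%BZ = 2 * ZtoR R z + 1 by rewrite ZtoRD two.
case: ifP => [H _ X Y|_ /and4P[/IH H00 /IH H10 /IH H01 /IH H11] X Y /andP[X0 X1] /andP[Y0 Y1]].
  exact: leaf.
(* Doubling all three coordinates makes each quarter of the cell a unit cell for the denominator
   [2 * N], and multiplies the value by a positive power of 2. *)
suff: 0 <= heval (ZtoR R (2 * N)%BZ) (2 * X) (2 * Y) e.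
  by rewrite two heval_homogeneous // pmulr_rge0 // exprn_gt0.
have [X2|/ltW X2] := leP (2 * X) (2 * ZtoR R i + 1);
have [Y2|/ltW Y2] := leP (2 * Y) (2 * ZtoR R j + 1).
- by apply: H00; rewrite two; apply/andP; split; lra.
- by apply: H01; rewrite ?two ?twoS; apply/andP; split; lra.
- by apply: H10; rewrite ?two ?twoS; apply/andP; split; lra.
- by apply: H11; rewrite twoS; apply/andP; split; lra.
Qed.

Definition nonneg_check (e : hexpr) : bool :=
  homogeneous e && cell_nonneg e 5 1%BZ 0%BZ 0%BZ.

Lemma heval_ge0 (R : realFieldType) (o x y : R) (e : hexpr) : nonneg_check e ->
  0 < o -> 0 <= x <= o -> 0 <= y <= o -> 0 <= heval o x y e.
Proof.
move=> /andP[he ce] o0 xo yo.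
have on0 : o != 0 by rewrite gt_eqF.
have := heval_homogeneous o 1 (o^-1 * x) (o^-1 * y) he.
rewrite mulr1 !mulVKf // => ->; rewrite mulr_ge0 ?exprn_ge0 ?(ltW o0) //.
apply: (cell_nonnegP he ce); rewrite [ZtoR R 0%BZ]/(0) add0r.
  by rewrite ler_pdivlMl // ler_pdivrMl // mulr0 mulr1.
by rewrite ler_pdivlMl // ler_pdivrMl // mulr0 mulr1.
Qed.

(** * The polynomial inequalities *)

Declare Scope hexpr_scope.
Delimit Scope hexpr_scope with H.
Bind Scope hexpr_scope with hexpr.
Coercion HC : Z >-> hexpr.
Infix "+" := HAdd : hexpr_scope.
Infix "-" := HSub : hexpr_scope.
Infix "*" := HMul : hexpr_scope.
Infix "^+" := HPow : hexpr_scope.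

Lemma ZtoR_pos (R : realFieldType) (p : positive) : ZtoR R (Zpos p) = (Pos.to_nat p)%:R.
Proof. by []. Qed.

Definition kappa (R : realFieldType) (t s : R) : R :=
  (1 + t) ^+ 3 + (1 - 3 * t) * s * (1 + t - s) - s ^+ 3.

Definition hkappa (u t s : hexpr) : hexpr :=
  ((u + t) ^+ 3 + (u - 3%BZ * t) * s * (u + t - s) - s ^+ 3)%H.

(* The variable [u] homogenizes: it stands for 1. *)
Definition hblock (u t s p q : hexpr) : hexpr :=
  (6%BZ ^+ 3 * 4%BZ ^+ 2 * p * (u - t) ^+ 2 * u ^+ 5
   - 5%BZ ^+ 5 * q * hkappa u t s * ((u - t) ^+ 2 - t * s) ^+ 2)%H.

Lemma ratio_unit (R : realFieldType) (s t : R) : 0 <= s <= t ->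
  exists2 y, 0 <= y <= 1 & s = t * y.
Proof.
move=> /andP[s0 st]; have [t0|t0] := eqVneq t 0.
  exists 0; first by rewrite lexx ler01.
  by move: st; rewrite t0 => st; apply/eqP; rewrite mulr0 eq_le st s0.
have tp : 0 < t by rewrite lt_def t0 (le_trans s0).
exists (s / t); last by field.
by rewrite divr_ge0 ?(ltW tp) //= ler_pdivrMr // mul1r.
Qed.

(** The quotient of the values of [hp] and [hq] is the slack allowed relative to the target constant
    [6^3 4^2 / 5^5], which is [root_cap] below. *)
Lemma hblock_ge0 (R : realFieldType) (t s o x y : R) (hu ht hs hp hq : hexpr) :
  nonneg_check (hblock hu ht hs hp hq) ->
  0 < o -> 0 <= x <= o -> 0 <= y <= o ->
  heval o x y hu = 1 -> heval o x y ht = t -> heval o x y hs = s ->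
  5 ^+ 5 * heval o x y hq * (kappa t s * ((1 - t) ^+ 2 - t * s) ^+ 2)
  <= 6 ^+ 3 * 4 ^+ 2 * heval o x y hp * (1 - t) ^+ 2.
Proof.
move=> ce o0 x01 y01 uE tE sE; have := heval_ge0 ce o0 x01 y01.
rewrite /= !ZtoR_pos /Pos.to_nat /= uE tE sE => H; rewrite -subr_ge0.
apply: le_trans H _; rewrite le_eqVlt; apply/orP; left; apply/eqP; rewrite /kappa; ring.
Qed.

(** The slack 401/400 absorbs the excess near [s = t]; it is repaid by the opposite slack 400/401 in
    [kappa_block_half]. *)
Lemma kappa_block_all (R : realFieldType) (t s : R) : 0 <= s <= t -> t <= 4 / 25 ->
  5 ^+ 5 * 20 ^+ 2 * (kappa t s * ((1 - t) ^+ 2 - t * s) ^+ 2)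
  <= 6 ^+ 3 * 4 ^+ 2 * (20 ^+ 2 + 1) * (1 - t) ^+ 2.
Proof.
move=> st t1; have [y /andP[y0 y1] sE] := ratio_unit st.
move/andP: st => [s0 st].
(* The triangle of the pairs [(t, s)] is the image of a square under [s = t y]. Quadratic forms
   stand for 1, [t] and [s], so that this product remains homogeneous. *)
pose hu := (25%BZ * HO * HO)%H; pose ht := (4%BZ * HX * HO)%H; pose hs := (4%BZ * HX * HY)%H.
have ce : nonneg_check (hblock hu ht hs (20%BZ ^+ 2 + 1%BZ) (20%BZ ^+ 2)) by vm_compute.
move: (@hblock_ge0 R t s (1 / 5) (5 / 4 * t) (y / 5) _ _ _ _ _ ce) => {ce}.
rewrite /= !ZtoR_pos /Pos.to_nat /=; apply.
- by lra.
- by apply/andP; split; lra.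
- by apply/andP; split; lra.
- by field.
- by field.
- by rewrite sE; field.
Qed.

Lemma kappa_block_half (R : realFieldType) (t s : R) : 0 <= s <= t / 2 -> t <= 4 / 25 ->
  5 ^+ 5 * (20 ^+ 2 + 1) * (kappa t s * ((1 - t) ^+ 2 - t * s) ^+ 2)
  <= 6 ^+ 3 * 4 ^+ 2 * 20 ^+ 2 * (1 - t) ^+ 2.
Proof.
move=> st t1; have [y /andP[y0 y1] sE] := ratio_unit st.
move/andP: st => [s0 st].
pose hu := (100%BZ * HO * HO)%H; pose ht := (16%BZ * HX * HO)%H; pose hs := (8%BZ * HX * HY)%H.
have ce : nonneg_check (hblock hu ht hs (20%BZ ^+ 2) (20%BZ ^+ 2 + 1%BZ)) by vm_compute.
move: (@hblock_ge0 R t s (1 / 10) (5 / 8 * t) (y / 10) _ _ _ _ _ ce) => {ce}.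
rewrite /= !ZtoR_pos /Pos.to_nat /=; apply.
- by lra.
- by apply/andP; split; lra.
- by apply/andP; split; lra.
- by field.
- by field.
- by rewrite sE; field.
Qed.

(** When [s] and [r] both exceed [t / 2], the factor [1 - 2sr] is at most [(1 - t^2/4)^2], which
    leaves one factor [1 - t^2/4] to damp each block. *)
Lemma kappa_block_damped (R : realFieldType) (t s : R) : 0 <= s <= t -> t <= 4 / 25 ->
  5 ^+ 5 * (4 - t ^+ 2) * (kappa t s * ((1 - t) ^+ 2 - t * s) ^+ 2)
  <= 6 ^+ 3 * 4 ^+ 2 * 4 * (1 - t) ^+ 2.
Proof.
move=> st t1; have [y /andP[y0 y1] sE] := ratio_unit st.
move/andP: st => [s0 st].
pose hu := (25%BZ * HO * HO)%H; pose ht := (4%BZ * HX * HO)%H; pose hs := (4%BZ * HX * HY)%H.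
have uE : 25 * (1 / 5) * (1 / 5) = 1 :> R by field.
have tE : 4 * (5 / 4 * t) * (1 / 5) = t by field.
have ce : nonneg_check (hblock hu ht hs (4%BZ * hu ^+ 2) (4%BZ * hu ^+ 2 - ht ^+ 2)) by vm_compute.
move: (@hblock_ge0 R t s (1 / 5) (5 / 4 * t) (y / 5) _ _ _ _ _ ce) => {ce}.
rewrite /= !ZtoR_pos /Pos.to_nat /= uE tE expr1n mulr1; apply.
- by lra.
- by apply/andP; split; lra.
- by apply/andP; split; lra.
- by [].
- by [].
- by rewrite sE; field.
Qed.

(** For the patterns with one exceptional sign, [(1 + 9t)^2] is the diagonal entry at the
    exceptional index, counted twice, and [(1 + t)^9] bounds the product of the complementary 3 x 3
    block. *)
Definition pre (R : realFieldType) (t : R) : R := (1 + 9 * t) ^+ 2 * (1 + t) ^+ 9.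
Definition hpre (u t : hexpr) := ((u + 9%BZ * t) ^+ 2 * (u + t) ^+ 9)%H.

(* a bound of [pre] of lower degree, to speed up computation *)
Definition pre_cubic (R : realFieldType) (t : R) : R :=
  (1 + 9 * t) ^+ 2 * (1 + 9 * t + 36 * t ^+ 2 + 107 * t ^+ 3).
Definition hpre_cubic (u t : hexpr) :=
  ((u + 9%BZ * t) ^+ 2
   * (u ^+ 3 + 9%BZ * t * u ^+ 2 + 36%BZ * t ^+ 2 * u + 107%BZ * t ^+ 3))%H.

Lemma pre_le_cubic (R : realFieldType) (t : R) : 0 <= t <= 3 / 20 -> pre t <= pre_cubic t.
Proof.
move=> /andP[t0 t1]; rewrite ler_wpM2l ?sqr_ge0 // -subr_ge0.
have -> : 1 + 9 * t + 36 * t ^+ 2 + 107 * t ^+ 3 - (1 + t) ^+ 9 =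
  t ^+ 3 * (23 - t * (126 + t * (126 + t * (84 + t * (36 + t * (9 + t)))))) by ring.
(* The nested form is bounded from the inside out; 23 = 107 - 84 is the surplus in the cubic
   coefficient. *)
have step (c d x : R) : 0 <= x -> x <= d -> 0 <= c -> 0 <= c + t * x <= c + 3 / 20 * d.
  by move=> x0 xd c0; rewrite addr_ge0 ?mulr_ge0 //= lerD2l ler_pM.
have /andP[p1 q1] : 0 <= 9 + t <= 10 by apply/andP; split; lra.
have /andP[p2 q2] := step 36 _ _ p1 q1 (ler0n R 36).
have /andP[p3 q3] := step 84 _ _ p2 q2 (ler0n R 84).
have /andP[p4 q4] := step 126 _ _ p3 q3 (ler0n R 126).
have /andP[p5 q5] := step 126 _ _ p4 q4 (ler0n R 126).
rewrite mulr_ge0 ?exprn_ge0 // subr_ge0.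
by apply: le_trans (ler_pM t0 p5 t1 q5) _; lra.
Qed.

(** The constant [6^12 4^8 / 5^20] is [cap] below, and the power of [u] equalises the degrees. *)
Definition hcap (u : hexpr) (d : nat) (k lhs : hexpr) : hexpr :=
  (6%BZ ^+ 12 * 4%BZ ^+ 8 * k * u ^+ d - 5%BZ ^+ 20 * lhs)%H.

Lemma hcap_ge0 (R : realFieldType) (o x y : R) (hu k lhs : hexpr) d :
  nonneg_check (hcap hu d k lhs) ->
  0 < o -> 0 <= x <= o -> 0 <= y <= o ->
  heval o x y hu = 1 ->
  5 ^+ 20 * heval o x y lhs <= 6 ^+ 12 * 4 ^+ 8 * heval o x y k.
Proof.
move=> ce o0 x01 y01 uE; have := heval_ge0 ce o0 x01 y01.
by rewrite /= !ZtoR_pos /Pos.to_nat /= uE expr1n mulr1 subr_ge0.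
Qed.

Lemma three_one_low (R : realFieldType) (t e : R) : 0 <= t <= 1 / 9 -> 0 <= e <= 9 / 4 ->
  5 ^+ 20 * (pre_cubic t * (1 - 9 * t + 9 * t ^+ 2 * e) ^+ 2 * ((1 - t * e) ^+ 2 + 9 * t))
  <= 6 ^+ 12 * 4 ^+ 8.
Proof.
move=> /andP[t0 t1] /andP[e0 e1].
pose u := (36%BZ * HO)%H; pose ht := (4%BZ * HX)%H; pose he := (81%BZ * HY)%H.
have uE : 36 * (1 / 36) = 1 :> R by field.
have tE : 4 * (t / 4) = t by field.
have eE : 81 * (e / 81) = e by field.
have ce : nonneg_check (hcap u 15 1%BZ
  (hpre_cubic u ht * (u ^+ 3 - 9%BZ * ht * u ^+ 2 + 9%BZ * ht ^+ 2 * he) ^+ 2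
   * ((u ^+ 2 - ht * he) ^+ 2 + 9%BZ * ht * u ^+ 3)))%H by vm_compute.
move: (@hcap_ge0 R (1 / 36) (t / 4) (e / 81) _ _ _ _ ce) => {ce}.
rewrite /= !ZtoR_pos /Pos.to_nat /= uE tE eE !expr1n !mulr1; apply.
- by lra.
- by apply/andP; split; lra.
- by apply/andP; split; lra.
- by [].
Qed.

Lemma three_one_mid (R : realFieldType) (t : R) : 1 / 9 <= t <= 3 / 20 ->
  5 ^+ 20 * (pre t * (2 - 9 * t) ^+ 4 * (1 + 9 * t)) <= 6 ^+ 12 * 4 ^+ 8 * 16.
Proof.
move=> /andP[t0 t1].
pose u := (180%BZ * HO)%H; pose ht := (20%BZ * HO + 7%BZ * HX)%H.
have uE : 180 * (1 / 180) = 1 :> R by field.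
have tE : 20 * (1 / 180) + 7 * ((t - 1 / 9) / 7) = t by field.
have ce : nonneg_check (hcap u 16 16%BZ
  (hpre u ht * (2%BZ * u - 9%BZ * ht) ^+ 4 * (u + 9%BZ * ht)))%H by vm_compute.
move: (@hcap_ge0 R (1 / 180) ((t - 1 / 9) / 7) 0 _ _ _ _ ce) => {ce}.
rewrite /= !ZtoR_pos /Pos.to_nat /= uE tE !mulr1; apply.
- by lra.
- by apply/andP; split; lra.
- by apply/andP; split; lra.
- by [].
Qed.

(** Here [f = (4e - 9) / 3] is Schur's lower bound for the product of three nonnegative numbers with
    sum 3 and second elementary symmetric function [e]. *)
Lemma three_one_schur (R : realFieldType) (t e f : R) :
  0 <= t <= 3 / 20 -> 0 <= f <= 1 -> e = (9 + 3 * f) / 4 ->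
  5 ^+ 20 * (pre_cubic t * (1 - 9 * t + 9 * t ^+ 2 * e - 27 * t ^+ 3 * f) ^+ 2
    * ((1 - t * e) ^+ 2 + t * (3 - t * f) ^+ 2)) <= 6 ^+ 12 * 4 ^+ 8.
Proof.
move=> /andP[t0 t1] /andP[f0 f1] ef.
pose u := (20%BZ * HO)%H; pose ht := (3%BZ * HX)%H.
pose he := (45%BZ * HO + 15%BZ * HY)%H; pose hf := (20%BZ * HY)%H.
have uE : 20 * (1 / 20) = 1 :> R by field.
have tE : 3 * (t / 3) = t by field.
have eE : 45 * (1 / 20) + 15 * (f / 20) = e by rewrite ef; field.
have fE : 20 * (f / 20) = f by field.
have ce : nonneg_check (hcap u 18 1%BZ
  (hpre_cubic u ht * (u ^+ 4 - 9%BZ * ht * u ^+ 3 + 9%BZ * ht ^+ 2 * he * u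
                - 27%BZ * ht ^+ 3 * hf) ^+ 2
   * (u * (u ^+ 2 - ht * he) ^+ 2 + ht * (3%BZ * u ^+ 2 - ht * hf) ^+ 2)))%H by vm_compute.
move: (@hcap_ge0 R (1 / 20) (t / 3) (f / 20) _ _ _ _ ce) => {ce}.
rewrite /= !ZtoR_pos /Pos.to_nat /= uE tE eE fE !expr1n !mulr1 (mul1r ((1 - t * e) ^+ 2)); apply.
- by lra.
- by apply/andP; split; lra.
- by apply/andP; split; lra.
- by [].
Qed.

Lemma three_one_high (R : realFieldType) (t : R) : 3 / 20 <= t <= 1 / 3 ->
  5 ^+ 20 * (64 * pre t * (1 - 3 * t) ^+ 6) <= 6 ^+ 12 * 4 ^+ 8 * 27.
Proof.
move=> /andP[t0 t1].
pose u := (60%BZ * HO)%H; pose ht := (9%BZ * HO + 11%BZ * HX)%H.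
have uE : 60 * (1 / 60) = 1 :> R by field.
have tE : 9 * (1 / 60) + 11 * ((t - 3 / 20) / 11) = t by field.
have ce : nonneg_check (hcap u 17 27%BZ
  (64%BZ * hpre u ht * (u - 3%BZ * ht) ^+ 6))%H by vm_compute.
move: (@hcap_ge0 R (1 / 60) ((t - 3 / 20) / 11) 0 _ _ _ _ ce) => {ce}.
rewrite /= !ZtoR_pos /Pos.to_nat /= uE tE; apply.
- by lra.
- by apply/andP; split; lra.
- by apply/andP; split; lra.
- by [].
Qed.

(** * Signs (+,-,-,-) *)

Section Inequality.
Variable R : realFieldType.
Implicit Types t s w D E Z W : R.

Definition cap : R := (6 / 5) ^+ 12 * (4 / 5) ^+ 8.

Lemma capE : 5 ^+ 20 * cap = 6 ^+ 12 * 4 ^+ 8.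
Proof. by rewrite /cap; field. Qed.

Lemma ler_cap (k x : R) : 0 < k -> 5 ^+ 20 * (k * x) <= 6 ^+ 12 * 4 ^+ 8 * k -> x <= cap.
Proof.
move=> k0; rewrite -capE [k * x]mulrC mulrA ler_pM2r //.
by rewrite ler_pM2l // exprn_gt0.
Qed.

Lemma amgm3 (a b c : R) : 0 <= a -> 0 <= b -> 0 <= c ->
  a * b * c <= ((a + b + c) / 3) ^+ 3.
Proof.
move=> a0 b0 c0.
rewrite -subr_ge0 (_ : _ - _ = ((a + b + c) / 2 * ((a - b) ^+ 2 + (a - c) ^+ 2 + (b - c) ^+ 2)
  + 3 * (a * (b - c) ^+ 2 + b * (a - c) ^+ 2 + c * (a - b) ^+ 2)) / 27); last by field.
by rewrite !(sqr_ge0, divr_ge0, addr_ge0, mulr_ge0).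
Qed.

Lemma schur3 (a b c : R) : 0 <= a -> 0 <= b -> 0 <= c ->
  0 <= a * (a - b) * (a - c) + b * (b - a) * (b - c) + c * (c - a) * (c - b).
Proof.
have min_last (x y z : R) : 0 <= x -> 0 <= z -> z <= x -> z <= y ->
    0 <= x * (x - y) * (x - z) + y * (y - x) * (y - z) + z * (z - x) * (z - y).
  move=> x0 z0 zx zy.
  rewrite (_ : _ + _ = (x - y) ^+ 2 * (x + y - z) + z * ((x - z) * (y - z))); last by ring.
  apply: addr_ge0; last by rewrite !mulr_ge0 // subr_ge0.
  by apply: mulr_ge0; [exact: sqr_ge0|lra].
move=> a0 b0 c0.
have [ab|/ltW ba] := leP a b; last have [bc|/ltW cb] := leP b c.
- have [ac|/ltW ca] := leP a c; last by apply: min_last => //; lra.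
  by have := min_last b c a b0 a0 ab ac; congr (0 <= _); ring.
- by have := min_last a c b a0 b0 ba bc; congr (0 <= _); ring.
- by apply: min_last => //; lra.
Qed.

(** The share of one coordinate [w] in the square of the product, once
    [(1 + twz)^2 <= (1 + tw^2)(1 + tz^2)] has separated the two vectors. *)
Definition phi t w : R := (1 - 3 * t * w) ^+ 2 * (1 + t * w ^+ 2).

(** The product of the [phi t w_i] is [b^2 q], where [b] and [q] decrease in the product [g] of the
    [w_i]. For [t <= 3/20] a lower bound of [g] is inserted, either Schur's or 0; for larger [t],
    AM-GM on [b] and on [q] is enough. *)
Lemma phi_prod_le t (w1 w2 w3 : R) : 0 <= t <= 1 / 3 ->
  0 <= w1 -> 0 <= w2 -> 0 <= w3 -> w1 + w2 + w3 = 3 ->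
  3 * t * w1 <= 1 -> 3 * t * w2 <= 1 -> 3 * t * w3 <= 1 ->
  pre t * (phi t w1 * phi t w2 * phi t w3) <= cap.
Proof.
move=> /andP[t0 t1] w10 w20 w30 ws l1 l2 l3.
have pre0 : 0 <= pre t by rewrite mulr_ge0 // exprn_ge0; lra.
pose e := w1 * w2 + w1 * w3 + w2 * w3; pose g := w1 * w2 * w3.
have e0 : 0 <= e by rewrite !addr_ge0 ?mulr_ge0.
have g0 : 0 <= g by rewrite !mulr_ge0.
have e3 : e <= 3.
  have -> : e = 3 - ((w1 - w2) ^+ 2 + (w1 - w3) ^+ 2 + (w2 - w3) ^+ 2) / 6.
    by rewrite /e (_ : w3 = 3 - w1 - w2); [field|lra].
  by rewrite gerBl !(sqr_ge0, divr_ge0, addr_ge0).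
have g1 : g <= 1 by have := amgm3 w10 w20 w30; rewrite ws divff ?expr1n //; lra.
have schur : 4 * e - 9 <= 3 * g.
  have := schur3 w10 w20 w30.
  rewrite (_ : _ + _ = 3 * (3 * g - (4 * e - 9))); first by rewrite pmulr_rge0 // subr_ge0.
  by rewrite /e /g (_ : w3 = 3 - w1 - w2); [ring|lra].
(* [b] and [q] are the products of the [1 - 3 t w_i] and of the [1 + t w_i^2]. *)
pose b := 1 - 9 * t + 9 * t ^+ 2 * e - 27 * t ^+ 3 * g.
pose q := (1 - t * e) ^+ 2 + t * (3 - t * g) ^+ 2.
have bE : b = (1 - 3 * t * w1) * (1 - 3 * t * w2) * (1 - 3 * t * w3).
  by rewrite /b /e /g (_ : w3 = 3 - w1 - w2); [ring|lra].
have b0 : 0 <= b by rewrite bE !mulr_ge0 // subr_ge0.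
(* The formula for [q] is the squared modulus of the product of the complex numbers
   [1 + i sqrt(t) w_k], in terms of the elementary symmetric functions. *)
have -> : phi t w1 * phi t w2 * phi t w3 = b ^+ 2 * q.
  by rewrite bE /phi /q /e /g (_ : w3 = 3 - w1 - w2); [ring|lra].
have tg : t * g <= 1 by nra.
have q0 : 0 <= q by rewrite addr_ge0 ?sqr_ge0 // mulr_ge0 ?sqr_ge0.
have [t15|/ltW t15] := leP (3 / 20) t.
  apply: (@ler_cap (27 / 64)); first by lra.
  have bb : b <= (1 - 3 * t) ^+ 3.
    rewrite bE; apply: le_trans (amgm3 _ _ _) _; rewrite ?subr_ge0 //.
    rewrite le_eqVlt; apply/orP; left; apply/eqP; congr (_ ^+ 3).
    by rewrite (_ : w3 = 3 - w1 - w2); [field|lra].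
  (* From [3 t w_i <= 1] follows [t w_i^2 <= w_i / 3], so the three factors of [q] have mean at most
     4/3. *)
  have qq : q <= 64 / 27.
    have -> : q = (1 + t * w1 ^+ 2) * (1 + t * w2 ^+ 2) * (1 + t * w3 ^+ 2).
      by rewrite /q /e /g (_ : w3 = 3 - w1 - w2); [ring|lra].
    apply: le_trans (amgm3 _ _ _) _; rewrite ?addr_ge0 ?mulr_ge0 ?sqr_ge0 //.
    have -> : 64 / 27 = (4 / 3) ^+ 3 :> R by field.
    by rewrite lerXn2r ?nnegrE //; nra.
  have := @three_one_high R t; rewrite t15 t1 => /(_ isT) H.
  have : b ^+ 2 * q <= (1 - 3 * t) ^+ 6 * (64 / 27).
    rewrite (exprM _ 3 2) ler_pM ?sqr_ge0 // lerXn2r ?nnegrE // exprn_ge0; lra.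
  move=> /(ler_wpM2l pre0)/(ler_wpM2l (exprn_ge0 20 (ler0n R 5))).
  move: (5 ^+ 20) (6 ^+ 12 * 4 ^+ 8) (pre t) (b ^+ 2 * q) ((1 - 3 * t) ^+ 6) H.
  by move=> k l p X Y; lra.
have pcap X : b ^+ 2 * q <= X -> 5 ^+ 20 * (pre_cubic t * X) <= 6 ^+ 12 * 4 ^+ 8 ->
    pre t * (b ^+ 2 * q) <= cap.
  move=> leX H; apply: (@ler_cap 1) => //; rewrite mul1r mulr1; apply: le_trans H.
  rewrite ler_pM2l ?exprn_gt0 //; apply: ler_pM leX => //; first by rewrite mulr_ge0 ?sqr_ge0.
  by apply: pre_le_cubic; rewrite t0.
(* Schur's bound for [g] is nonnegative exactly from [e = 9/4] on; below that value [g >= 0] is used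
   instead. *)
have [e94|/ltW e94] := leP (9 / 4) e.
  pose f := (4 * e - 9) / 3.
  have f01 : 0 <= f <= 1 by rewrite /f; apply/andP; split; lra.
  have ef : e = (9 + 3 * f) / 4 by rewrite /f; field.
  have fg : f <= g by rewrite /f; lra.
  have t0f : 0 <= t * f by case/andP: f01 => f0 _; rewrite mulr_ge0.
  have tfg : t * f <= t * g by rewrite ler_wpM2l.
  have := @three_one_schur R t e f; rewrite t0 t15 => /(_ isT f01 ef) H.
  apply: (pcap ((1 - 9 * t + 9 * t ^+ 2 * e - 27 * t ^+ 3 * f) ^+ 2
     * ((1 - t * e) ^+ 2 + t * (3 - t * f) ^+ 2))); last by rewrite [pre_cubic t * _]mulrA.
  have bf : b <= 1 - 9 * t + 9 * t ^+ 2 * e - 27 * t ^+ 3 * f.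
    by rewrite /b lerD2l lerN2 ler_wpM2l // mulr_ge0 // exprn_ge0.
  rewrite ler_pM ?sqr_ge0 // ?lerXn2r ?nnegrE //; first by exact: le_trans bf.
  by rewrite /q lerD2l ler_wpM2l // lerXn2r ?nnegrE //; lra.
have bb : b <= 1 - 9 * t + 9 * t ^+ 2 * e.
  by rewrite /b gerBl !mulr_ge0 ?exprn_ge0.
have qq : q <= (1 - t * e) ^+ 2 + 9 * t.
  have -> : 9 * t = t * 3 ^+ 2 by ring.
  have tg0 : 0 <= t * g by rewrite mulr_ge0.
  by rewrite lerD2l ler_wpM2l // lerXn2r ?nnegrE //; lra.
have te0 : 0 <= t * e by rewrite mulr_ge0.
have [t19|/ltW t19] := leP t (1 / 9).
  have := @three_one_low R t e; rewrite t0 t19 e0 e94 => /(_ isT isT) H.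
  apply: (pcap ((1 - 9 * t + 9 * t ^+ 2 * e) ^+ 2 * ((1 - t * e) ^+ 2 + 9 * t)));
    last by rewrite [pre_cubic t * _]mulrA.
  by rewrite ler_pM ?sqr_ge0 // lerXn2r ?nnegrE //; exact: le_trans bb.
have := @three_one_mid R t; rewrite t19 t15 => /(_ isT) H.
apply: (@ler_cap 16) => //; apply: le_trans H; rewrite ler_pM2l ?exprn_gt0 //.
(* At [e = 9/4] the bound of [b] becomes the perfect square [(2 - 9t)^2 / 4]. *)
have b2 : 2 * b <= (2 - 9 * t) ^+ 2 / 2.
  have : t ^+ 2 * e <= t ^+ 2 * (9 / 4) by rewrite ler_wpM2l ?sqr_ge0.
  have : (2 - 9 * t) ^+ 2 / 2 = 2 * (1 - 9 * t + 9 * (t ^+ 2 * (9 / 4))) by field.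
  by lra.
have q2 : q <= 1 + 9 * t.
  apply: le_trans qq _; rewrite lerD2r expr_le1 //; nra.
have : (2 * b) ^+ 2 * q <= ((2 - 9 * t) ^+ 2 / 2) ^+ 2 * (1 + 9 * t).
  have b20 : 0 <= 2 * b by rewrite mulr_ge0.
  by rewrite ler_pM ?sqr_ge0 // lerXn2r ?nnegrE //; exact: le_trans b2.
move=> /(ler_wpM2l pre0).
have -> : ((2 - 9 * t) ^+ 2 / 2) ^+ 2 = (2 - 9 * t) ^+ 4 / 4 by field.
rewrite exprMn; move: (pre t) (b ^+ 2) ((2 - 9 * t) ^+ 4) => p X Y; lra.
Qed.
End Inequality.

(** * Separating the two vectors when one sign is exceptional *)

Section ThreeOne.
Variable R : realFieldType.

Lemma ler_pM3 (a b c a' b' c' : R) : 0 <= a -> 0 <= b -> 0 <= c ->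
  a <= a' -> b <= b' -> c <= c' -> a * b * c <= a' * b' * c'.
Proof. by move=> a0 b0 c0 aa bb cc; rewrite !ler_pM // mulr_ge0. Qed.

(** AM-GM along rows and then over the rows bounds the 3 x 3 block by [(1 + t)^9]. The square of its
    extra diagonal factor splits by Cauchy-Schwarz, so the square of the whole is at most a function
    of the [w_i] times the same function of the [z_i], each at most [cap]. *)
Lemma three_one_normalized (t w1 w2 w3 z1 z2 z3 : R) : 0 <= t <= 1 / 3 ->
  0 <= w1 -> 0 <= w2 -> 0 <= w3 -> w1 + w2 + w3 = 3 ->
  0 <= z1 -> 0 <= z2 -> 0 <= z3 -> z1 + z2 + z3 = 3 ->
  3 * t * w1 <= 1 -> 3 * t * w2 <= 1 -> 3 * t * w3 <= 1 ->
  3 * t * z1 <= 1 -> 3 * t * z2 <= 1 -> 3 * t * z3 <= 1 ->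
  (1 + 9 * t) ^+ 2
  * ((1 - 3 * t * w1) * (1 - 3 * t * w2) * (1 - 3 * t * w3))
  * ((1 - 3 * t * z1) * (1 - 3 * t * z2) * (1 - 3 * t * z3))
  * ((1 + t * w1 * z1) * (1 + t * w2 * z2) * (1 + t * w3 * z3))
  * (((1 + t * w1 * z1) * (1 + t * w1 * z2) * (1 + t * w1 * z3))
     * ((1 + t * w2 * z1) * (1 + t * w2 * z2) * (1 + t * w2 * z3))
     * ((1 + t * w3 * z1) * (1 + t * w3 * z2) * (1 + t * w3 * z3))) <= cap R.
Proof.
move=> t13 w10 w20 w30 ws z10 z20 z30 zs lw1 lw2 lw3 lz1 lz2 lz3.
have /andP[t0 t1] := t13.
have Hw := phi_prod_le t13 w10 w20 w30 ws lw1 lw2 lw3.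
have Hz := phi_prod_le t13 z10 z20 z30 zs lz1 lz2 lz3.
have cap0 : 0 <= cap R by rewrite /cap mulr_ge0 // exprn_ge0 // divr_ge0.
have pos w z : 0 <= w -> 0 <= z -> 0 <= 1 + t * w * z.
  by move=> w0 z0; rewrite addr_ge0 // !mulr_ge0.
have row w : 0 <= w -> (1 + t * w * z1) * (1 + t * w * z2) * (1 + t * w * z3) <= (1 + t * w) ^+ 3.
  move=> w0; apply: le_trans (amgm3 _ _ _) _; rewrite ?pos //.
  rewrite le_eqVlt; apply/orP; left; apply/eqP; congr (_ ^+ 3).
  by rewrite (_ : z3 = 3 - z1 - z2); [field|lra].
have row0 w : 0 <= w -> 0 <= (1 + t * w * z1) * (1 + t * w * z2) * (1 + t * w * z3).
  by move=> w0; rewrite !mulr_ge0 // pos.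
have tw0 w : 0 <= w -> 0 <= 1 + t * w by move=> w0; rewrite addr_ge0 // mulr_ge0.
set A := _ * _ * (1 - 3 * t * w3); set B := _ * _ * (1 - 3 * t * z3).
set D := (X in _ * X * _ <= _); set M := (X in _ * X <= _).
have MM : M <= (1 + t) ^+ 9.
  apply: (@le_trans _ _ ((1 + t * w1) ^+ 3 * (1 + t * w2) ^+ 3 * (1 + t * w3) ^+ 3)).
    by apply: ler_pM3; [exact: row0|exact: row0|exact: row0|exact: row|exact: row|exact: row].
  rewrite -!exprMn (exprM _ 3 3) lerXn2r ?nnegrE ?mulr_ge0 ?tw0 // ?exprn_ge0 ?addr_ge0 //.
  apply: le_trans (amgm3 _ _ _) _; rewrite ?tw0 //.
  rewrite le_eqVlt; apply/orP; left; apply/eqP; congr (_ ^+ 3).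
  by rewrite (_ : w3 = 3 - w1 - w2); [field|lra].
have A0 : 0 <= A by rewrite !mulr_ge0 // subr_ge0.
have B0 : 0 <= B by rewrite !mulr_ge0 // subr_ge0.
have D0 : 0 <= D by rewrite /D !mulr_ge0 // pos.
have DD : D ^+ 2 <= ((1 + t * w1 ^+ 2) * (1 + t * w2 ^+ 2) * (1 + t * w3 ^+ 2))
                  * ((1 + t * z1 ^+ 2) * (1 + t * z2 ^+ 2) * (1 + t * z3 ^+ 2)).
  have cs w z : (1 + t * w * z) ^+ 2 <= (1 + t * w ^+ 2) * (1 + t * z ^+ 2).
    rewrite -subr_ge0 (_ : _ - _ = t * (w - z) ^+ 2); last by ring.
    by rewrite mulr_ge0 ?sqr_ge0.
  rewrite /D !exprMn.
  have -> : forall a b c d e f : R, (a * b * c) * (d * e * f) = (a * d) * (b * e) * (c * f).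
    by move=> *; ring.
  by apply: ler_pM3; rewrite ?cs ?sqr_ge0.
have G0 : 0 <= (1 + 9 * t) ^+ 2 * A * B * D by apply/mulr_ge0/D0/mulr_ge0/B0/mulr_ge0/A0/sqr_ge0.
have pre0 : 0 <= pre t by rewrite mulr_ge0 // exprn_ge0 // addr_ge0 // mulr_ge0.
have phi0 w : 0 <= phi t w := mulr_ge0 (sqr_ge0 _) (addr_ge0 ler01 (mulr_ge0 t0 (sqr_ge0 _))).
apply: (@le_trans _ _ ((1 + 9 * t) ^+ 2 * A * B * D * (1 + t) ^+ 9)).
  by rewrite ler_wpM2l.
have L0 := mulr_ge0 G0 (exprn_ge0 9 (addr_ge0 ler01 t0)).
rewrite -ler_sqr ?nnegrE //.
apply: le_trans (_ : _ <= cap R * cap R) _; last by rewrite expr2.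
apply: le_trans (ler_pM _ _ Hw Hz); last 2 first.
- exact: (mulr_ge0 pre0 (mulr_ge0 (mulr_ge0 (phi0 _) (phi0 _)) (phi0 _))).
- exact: (mulr_ge0 pre0 (mulr_ge0 (mulr_ge0 (phi0 _) (phi0 _)) (phi0 _))).
have c0 : 0 <= pre t ^+ 2 * A ^+ 2 * B ^+ 2 by apply/mulr_ge0/sqr_ge0/mulr_ge0/sqr_ge0/sqr_ge0.
rewrite (_ : ((1 + 9 * t) ^+ 2 * A * B * D * (1 + t) ^+ 9) ^+ 2
  = pre t ^+ 2 * A ^+ 2 * B ^+ 2 * D ^+ 2); last by rewrite /pre; ring.
apply: le_trans (ler_wpM2l c0 DD) _.
by rewrite le_eqVlt; apply/orP; left; apply/eqP; rewrite /A /B /phi; ring.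
Qed.

Lemma triple_ratio (u1 u2 u3 : R) : 0 <= u1 -> 0 <= u2 -> 0 <= u3 ->
  exists w : R * R * R, let: (w1, w2, w3) := w in let x := (u1 + u2 + u3) / 3 in
  [/\ [/\ 0 <= w1, 0 <= w2 & 0 <= w3], w1 + w2 + w3 = 3, u1 = x * w1, u2 = x * w2 & u3 = x * w3].
Proof.
move=> u10 u20 u30; have [S0|S0] := eqVneq (u1 + u2 + u3) 0.
  (* If all three numbers vanish the weights are arbitrary; equal ones keep the sum 3. *)
  by exists (1, 1, 1); split=> //=; rewrite ?S0; lra.
have Sp : 0 < u1 + u2 + u3 by rewrite lt_def S0 !addr_ge0.
exists (3 * u1 / (u1 + u2 + u3), 3 * u2 / (u1 + u2 + u3), 3 * u3 / (u1 + u2 + u3)).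
split; try by field.
by split; rewrite divr_ge0 ?mulr_ge0 // ltW.
Qed.

(** Up to sign, [U] and [V] are the coordinates at the exceptional index, by the zero sums; one
    statement thus serves both patterns (+,-,-,-) and (+,+,+,-). *)
Lemma three_one_le (u1 u2 u3 v1 v2 v3 : R) :
  0 <= u1 -> 0 <= u2 -> 0 <= u3 -> 0 <= v1 -> 0 <= v2 -> 0 <= v3 ->
  let U := u1 + u2 + u3 in let V := v1 + v2 + v3 in
  U * v1 <= 1 -> U * v2 <= 1 -> U * v3 <= 1 -> V * u1 <= 1 -> V * u2 <= 1 -> V * u3 <= 1 ->
  (1 + U * V) ^+ 2
  * ((1 - V * u1) * (1 - V * u2) * (1 - V * u3)) * ((1 - U * v1) * (1 - U * v2) * (1 - U * v3))
  * ((1 + u1 * v1) * (1 + u2 * v2) * (1 + u3 * v3))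
  * (((1 + u1 * v1) * (1 + u1 * v2) * (1 + u1 * v3))
     * ((1 + u2 * v1) * (1 + u2 * v2) * (1 + u2 * v3))
     * ((1 + u3 * v1) * (1 + u3 * v2) * (1 + u3 * v3))) <= cap R.
Proof.
move=> u10 u20 u30 v10 v20 v30 U V.
have U0 : 0 <= U by rewrite !addr_ge0.
have V0 : 0 <= V by rewrite !addr_ge0.
have [[[w1 w2] w3] /= [[w10 w20 w30] ws]] := triple_ratio u10 u20 u30.
have [[[z1 z2] z3] /= [[z10 z20 z30] zs]] := triple_ratio v10 v20 v30.
rewrite -/U -/V => v1E v2E v3E u1E u2E u3E.
pose t := U * V / 9.
have uvE u v w z : u = U / 3 * w -> v = V / 3 * z -> u * v = t * w * z.
  by move=> -> ->; rewrite /t; field.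
have UvE v z : v = V / 3 * z -> U * v = 3 * t * z by move=> ->; rewrite /t; field.
have VuE u w : u = U / 3 * w -> V * u = 3 * t * w by move=> ->; rewrite /t; field.
rewrite (UvE _ _ v1E) (UvE _ _ v2E) (UvE _ _ v3E) (VuE _ _ u1E) (VuE _ _ u2E) (VuE _ _ u3E).
rewrite (uvE _ _ _ _ u1E v1E) (uvE _ _ _ _ u1E v2E) (uvE _ _ _ _ u1E v3E).
rewrite (uvE _ _ _ _ u2E v1E) (uvE _ _ _ _ u2E v2E) (uvE _ _ _ _ u2E v3E).
rewrite (uvE _ _ _ _ u3E v1E) (uvE _ _ _ _ u3E v2E) (uvE _ _ _ _ u3E v3E).
rewrite (_ : U * V = 9 * t); last by rewrite /t; field.
move=> lz1 lz2 lz3 lw1 lw2 lw3.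
apply: three_one_normalized => //.
rewrite /t divr_ge0 ?mulr_ge0 //=.
have -> : U * V / 9 = t by [].
(* Adding the three constraints [3 t w_i <= 1] gives [9t <= 3]. *)
have : 3 * t * (w1 + w2 + w3) <= 3 by lra.
by rewrite ws; lra.
Qed.
End ThreeOne.

(** * Signs (+,+,-,-) *)

Section TwoTwo.
Variable R : realFieldType.
Implicit Types t s D E : R.

Definition root_cap : R := (6 / 5) ^+ 3 * (4 / 5) ^+ 2.

Lemma root_cap_ge0 : 0 <= root_cap.
Proof. by rewrite mulr_ge0 // exprn_ge0 // divr_ge0. Qed.

Lemma root_capX4 : root_cap ^+ 4 = cap R.
Proof. by rewrite /root_cap /cap; field. Qed.

Lemma balanced_le t : 0 <= t <= 1 -> (1 + t) ^+ 3 * (1 - t) ^+ 2 <= root_cap.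
Proof.
move=> /andP[t0 t1]; rewrite -subr_ge0.
(* The maximum is attained at [t = 1/5], a double root of the difference. *)
have -> : root_cap - (1 + t) ^+ 3 * (1 - t) ^+ 2
  = (t - 1 / 5) ^+ 2 * (331 / 125 + 37 / 25 * t - 7 / 5 * t ^+ 2 - t ^+ 3).
  by rewrite /root_cap; field.
rewrite mulr_ge0 ?sqr_ge0 //.
have t2 : t ^+ 2 <= 1 by rewrite expr_le1.
have t3 : t ^+ 3 <= 1 by rewrite expr_le1.
by lra.
Qed.

(** The 2 x 2 block of entries at two indices of equal sign, its diagonal counted twice; [cross] is
    a block whose row and column signs differ. *)
Definition block t D E : R :=
  (1 + t * (1 + D) * (1 + E)) ^+ 2 * (1 + t * (1 - D) * (1 - E)) ^+ 2
  * ((1 + t * (1 + D) * (1 - E)) * (1 + t * (1 - D) * (1 + E))).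

Definition cross t D E : R :=
  (1 - t * (1 + D) * (1 + E)) * (1 - t * (1 - D) * (1 - E))
  * ((1 - t * (1 + D) * (1 - E)) * (1 - t * (1 - D) * (1 + E))).

Definition damped t s : R := kappa t s * ((1 - t) ^+ 2 - t * s) ^+ 2.

Lemma kappaE t s :
  kappa t s = ((1 + t) ^+ 2 + 2 * (1 - t) * s + s ^+ 2) * (1 + t - s).
Proof. by rewrite /kappa; ring. Qed.

Lemma kappa_ge0 t s : 0 <= t <= 1 -> 0 <= s <= t -> 0 <= kappa t s.
Proof.
move=> /andP[t0 t1] /andP[s0 st]; rewrite kappaE mulr_ge0 //; last by lra.
by rewrite !addr_ge0 ?sqr_ge0 // !mulr_ge0 // subr_ge0.
Qed.

(** Multiplying opposite corners leaves, apart from a term in [(t (D - E))^2] of favourable sign, a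
    function of [t] and [s = tDE] alone. *)
Lemma block_le t D E : 0 <= t <= 1 -> 0 <= D <= 1 -> 0 <= E <= 1 ->
  0 <= block t D E <= kappa t (t * D * E) ^+ 2.
Proof.
move=> /andP[t0 t1] /andP[D0 D1] /andP[E0 E1].
have entry x y : 0 <= x -> 0 <= y -> 0 <= 1 + t * x * y.
  by move=> x0 y0; rewrite addr_ge0 // !mulr_ge0.
have Dp : 0 <= 1 + D by lra.
have Dm : 0 <= 1 - D by lra.
have Ep : 0 <= 1 + E by lra.
have Em : 0 <= 1 - E by lra.
rewrite /block -exprMn kappaE.
set A := _ * (1 + t * (1 - D) * (1 - E)); set B := (X in _ <= _ * X <= _).
have A0 : 0 <= A by rewrite mulr_ge0 // entry.
have B0 : 0 <= B by rewrite mulr_ge0 // entry.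
rewrite mulr_ge0 ?sqr_ge0 //= [X in _ <= X]exprMn.
have AA : A <= (1 + t) ^+ 2 + 2 * (1 - t) * (t * D * E) + (t * D * E) ^+ 2.
  rewrite -subr_ge0 (_ : _ - A = (t * (D - E)) ^+ 2) ?sqr_ge0 //.
  by rewrite /A; ring.
have BB : B <= (1 + t - t * D * E) ^+ 2.
  rewrite -subr_ge0 (_ : _ - B = (t * (D - E)) ^+ 2) ?sqr_ge0 //.
  by rewrite /B; ring.
by rewrite ler_pM ?sqr_ge0 // lerXn2r ?nnegrE //; exact: le_trans AA.
Qed.

Lemma cross_le t D E : 0 <= t <= 1 / 3 -> 0 <= D <= 1 -> 0 <= E <= 1 ->
  cross t D E * (1 - t) ^+ 4 <=
  (((1 - t) ^+ 2 - t ^+ 2 * D ^+ 2) * ((1 - t) ^+ 2 - t ^+ 2 * E ^+ 2)) ^+ 2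
  * (1 - 2 * (t * D * E) ^+ 2).
Proof.
move=> /andP[t0 t1] /andP[D0 D1] /andP[E0 E1].
set n := 1 - t; set g := _ * (n ^+ 2 - t ^+ 2 * E ^+ 2); pose p := (t * D * E) ^+ 2.
have p0 : 0 <= p by rewrite sqr_ge0.
have pt : p <= t ^+ 2.
  rewrite /p -mulrA exprMn ler_piMr ?sqr_ge0 // expr_le1 // ?mulr_ge0 //.
  by rewrite mulr_ile1.
have n0 : 0 <= n by rewrite /n; lra.
have n1 : n <= 1 by rewrite /n; lra.
have nt : t <= n by rewrite /n; lra.
have sub x : 0 <= x <= 1 -> 0 <= n ^+ 2 - t ^+ 2 * x ^+ 2 <= n ^+ 2.
  move=> /andP[x0 x1]; rewrite subr_ge0 gerBl -exprMn sqr_ge0 andbT.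
  rewrite lerXn2r ?nnegrE ?mulr_ge0 //; apply: le_trans nt; exact: ler_piMr.
have /andP[gD0 gD1] := sub D ltac:(by rewrite D0).
have /andP[gE0 gE1] := sub E ltac:(by rewrite E0).
have g0 : 0 <= g by rewrite mulr_ge0.
have g1 : g <= n ^+ 4 by rewrite (exprD n 2 2) ler_pM.
(* After multiplication by [n^4] the product is a square minus a correction, and the claim compares
   the terms carrying a factor [p]. *)
have -> : cross t D E * n ^+ 4 = (g + p * (1 - 2 * t)) ^+ 2 - 4 * p * n ^+ 4.
  by rewrite /cross /g /p /n; ring.
have n41 : n ^+ 4 <= 1 by rewrite expr_le1.
have n40 : 0 <= n ^+ 4 by rewrite exprn_ge0.
have g2 : g ^+ 2 <= n ^+ 4 by rewrite expr2 (le_trans (ler_pM g0 g0 g1 (le_trans g1 n41))) ?mulr1.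
have tn : (1 - 2 * t) ^+ 2 <= n ^+ 4.
  rewrite (exprM n 2 2) lerXn2r ?nnegrE ?exprn_ge0 //; first by lra.
  by rewrite -subr_ge0 (_ : _ - _ = t ^+ 2) ?sqr_ge0 // /n; ring.
have pt4 : p <= 4 * t by apply: le_trans pt _; nra.
have h1 : g * (1 - 2 * t) <= n ^+ 4 * (1 - 2 * t) by rewrite ler_wpM2r //; lra.
have h2 : p * (1 - 2 * t) ^+ 2 <= 4 * t * n ^+ 4 by rewrite ler_pM // sqr_ge0.
(* The bounds are all multiples of [n^4], and their coefficients balance:
   [2(1 - 2t) + 4t + 2 - 4 = 0]. *)
have : p * (2 * g * (1 - 2 * t) + p * (1 - 2 * t) ^+ 2 + 2 * g ^+ 2 - 4 * n ^+ 4) <= 0.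
  rewrite mulr_ge0_le0 //; move: (n ^+ 4) (g ^+ 2) (p * (1 - 2 * t) ^+ 2) h1 h2 g2 => N G P.
  by lra.
rewrite -/p; lra.
Qed.

(** The hypothesis concerns the smallest of the four factors, so all are nonnegative; AM-GM is then
    applied in [E] and afterwards in [D]. *)
Lemma cross_le_amgm t D E : 0 <= t <= 1 -> 0 <= D <= 1 -> 0 <= E <= 1 ->
  t * (1 + D) * (1 + E) <= 1 -> 0 <= cross t D E <= (1 - t) ^+ 4.
Proof.
move=> /andP[t0 t1] /andP[D0 D1] /andP[E0 E1] tDE.
have entry x y : 0 <= x <= 1 + D -> 0 <= y <= 1 + E -> 0 <= 1 - t * x * y.
  move=> /andP[x0 xD] /andP[y0 yE]; rewrite subr_ge0; apply: le_trans tDE.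
  by rewrite ler_pM ?mulr_ge0 // ler_wpM2l.
have Dp : 0 <= 1 + D <= 1 + D by rewrite lexx andbT; lra.
have Dm : 0 <= 1 - D <= 1 + D by apply/andP; split; lra.
have Ep : 0 <= 1 + E <= 1 + E by rewrite lexx andbT; lra.
have Em : 0 <= 1 - E <= 1 + E by apply/andP; split; lra.
have E1E : 0 <= (1 : R) <= 1 + E by rewrite ler01 lerDl.
rewrite {1}/cross !mulr_ge0 ?entry //=.
have col x : 0 <= x <= 1 + D ->
    0 <= (1 - t * x * (1 + E)) * (1 - t * x * (1 - E)) <= (1 - t * x) ^+ 2.
  move=> xD; rewrite mulr_ge0 ?entry //= -subr_ge0.
  by rewrite (_ : _ - _ = (t * x * E) ^+ 2) ?sqr_ge0 //; ring.
have /andP[cp0 cp1] := col _ Dp; have /andP[cm0 cm1] := col _ Dm.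
have -> : cross t D E = (1 - t * (1 + D) * (1 + E)) * (1 - t * (1 + D) * (1 - E))
    * ((1 - t * (1 - D) * (1 + E)) * (1 - t * (1 - D) * (1 - E))) by rewrite /cross; ring.
apply: le_trans (ler_pM cp0 cm0 cp1 cm1) _.
rewrite -exprMn (exprM _ 2 2) lerXn2r ?nnegrE ?sqr_ge0 //.
  have := entry _ _ Dp E1E; have := entry _ _ Dm E1E; rewrite !mulr1 => ? ?.
  exact: mulr_ge0.
by rewrite -subr_ge0 (_ : _ - _ = (t * D) ^+ 2) ?sqr_ge0 //; ring.
Qed.

Lemma damped_ge0 t s : 0 <= t <= 1 -> 0 <= s <= t -> 0 <= damped t s.
Proof. by move=> t01 st; rewrite mulr_ge0 ?kappa_ge0 ?sqr_ge0. Qed.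

Lemma root_cap_scaled : 5 ^+ 5 * root_cap = 6 ^+ 3 * 4 ^+ 2.
Proof. by rewrite /root_cap; field. Qed.

(** If one of [s], [r] is at most [t / 2], the slacks 400/401 and 401/400 cancel; otherwise
    [1 - 2sr] supplies the damping for both blocks. *)
Lemma damped_mul_le_low t (s r : R) : 0 <= t <= 4 / 25 -> 0 <= s <= t -> 0 <= r <= t ->
  damped t s * damped t r * (1 - 2 * s * r) <= (root_cap * (1 - t) ^+ 2) ^+ 2.
Proof.
move=> /andP[t0 t1]; have t01 : 0 <= t <= 1 by apply/andP; split; lra.
set N := root_cap * _.
have N0 : 0 <= N by rewrite mulr_ge0 ?root_cap_ge0 ?sqr_ge0.
have all_le x : 0 <= x <= t -> damped t x * 20 ^+ 2 <= (20 ^+ 2 + 1) * N.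
  move=> xt; have := kappa_block_all xt t1; rewrite -root_cap_scaled -/(damped t x).
  rewrite (_ : _ * root_cap * _ * _ = 5 ^+ 5 * ((20 ^+ 2 + 1) * N)); last by rewrite /N; ring.
  by rewrite -mulrA ler_pM2l ?exprn_gt0 // mulrC.
have half_le x : 0 <= x <= t / 2 -> damped t x * (20 ^+ 2 + 1) <= 20 ^+ 2 * N.
  move=> xt; have := kappa_block_half xt t1; rewrite -root_cap_scaled -/(damped t x).
  rewrite (_ : _ * root_cap * _ * _ = 5 ^+ 5 * (20 ^+ 2 * N)); last by rewrite /N; ring.
  by rewrite -mulrA ler_pM2l ?exprn_gt0 // mulrC.
have damp_le x : 0 <= x <= t -> damped t x * (1 - t ^+ 2 / 4) <= N.
  move=> xt; have := kappa_block_damped xt t1; rewrite -root_cap_scaled -/(damped t x).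
  rewrite (_ : _ * root_cap * _ * _ = 5 ^+ 5 * (4 * N)); last by rewrite /N; ring.
  rewrite -mulrA ler_pM2l ?exprn_gt0 //; move: (damped t x) (t ^+ 2) => K T; lra.
have mixed x y : 0 <= x <= t / 2 -> 0 <= y <= t ->
    damped t x * damped t y * (1 - 2 * x * y) <= N ^+ 2.
  move=> xt yt; have /andP[x0 x2] := xt; have /andP[y0 y1] := yt.
  have xt' : 0 <= x <= t by apply/andP; split; lra.
  have K0 := damped_ge0 t01 xt'; have K1 := damped_ge0 t01 yt.
  apply: (@le_trans _ _ (damped t x * damped t y)).
    by apply: ler_piMr; [exact: mulr_ge0|rewrite gerBl !mulr_ge0].
  have c0 : (0 : R) <= 20 ^+ 2 + 1 by rewrite addr_ge0 // exprn_ge0.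
  have := ler_pM (mulr_ge0 K0 c0) (mulr_ge0 K1 (exprn_ge0 2 (ler0n R 20)))
    (half_le x xt) (all_le y yt).
  rewrite mulrACA [X in _ <= X](_ : _ = N ^+ 2 * ((20 ^+ 2 + 1) * 20 ^+ 2)); last by ring.
  by rewrite ler_pM2r // mulr_gt0 ?addr_gt0 ?exprn_gt0.
move=> st rt; have /andP[s0 s1] := st; have /andP[r0 r1] := rt.
have [s2|/ltW s2] := leP s (t / 2); first by apply: mixed => //; rewrite s0.
have [r2|/ltW r2] := leP r (t / 2).
  rewrite (_ : _ * _ = damped t r * damped t s * (1 - 2 * r * s)); last by ring.
  by apply: mixed => //; rewrite r0.
have K0 := damped_ge0 t01 st; have K1 := damped_ge0 t01 rt.
have T0 : 0 <= 1 - t ^+ 2 / 4.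
  have : t ^+ 2 <= 1 by rewrite expr_le1 //; case/andP: t01.
  by lra.
apply: (@le_trans _ _ (damped t s * damped t r * (1 - t ^+ 2 / 4) ^+ 2)).
  apply: ler_wpM2l; first exact: mulr_ge0.
  have sr : t / 2 * (t / 2) <= s * r by rewrite ler_pM ?divr_ge0.
  have : 0 <= (t ^+ 2 / 4) ^+ 2 by rewrite sqr_ge0.
  by lra.
rewrite (_ : _ * _ = damped t s * (1 - t ^+ 2 / 4) * (damped t r * (1 - t ^+ 2 / 4))); last by ring.
rewrite expr2; apply: ler_pM; rewrite ?damp_le //; exact: mulr_ge0.
Qed.

(** In this range [damped t s] is at most its value at [s = 0]: with [n2 = (1 - t)^2], [kappa] grows
    at most like [n2 + 2ts], and [(n2 + 2ts)(n2 - ts)^2 <= n2^3]. *)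
Lemma damped_le_mid t s : 4 / 25 <= t <= 1 / 3 -> 0 <= s <= t ->
  damped t s <= root_cap * (1 - t) ^+ 2.
Proof.
move=> /andP[t0 t1] /andP[s0 s1]; have t01 : 0 <= t <= 1 by apply/andP; split; lra.
set n2 := (1 - t) ^+ 2; have n20 : 0 < n2 by rewrite exprn_gt0 //; lra.
apply: (@le_trans _ _ ((1 + t) ^+ 3 * n2 ^+ 2)); last first.
  rewrite expr2 mulrA ler_wpM2r ?(ltW n20) //; exact: balanced_le.
have ts0 : 0 <= t * s by rewrite mulr_ge0 //; lra.
have tsn : t * s <= n2 by rewrite /n2 expr2; apply: ler_pM; lra.
have kap : n2 * kappa t s <= (1 + t) ^+ 3 * (n2 + 2 * (t * s)).
  have tE : (1 - 3 * t) * n2 <= 2 * t * (1 + t) ^+ 2.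
    rewrite -subr_ge0 (_ : _ - _ = 3 * ((t - 4 / 25) * (1 / 3 - t))
      + (138 / 25 * t - 21 / 25) + 5 * t ^+ 3); last by rewrite /n2; field.
    have tt : 0 <= (t - 4 / 25) * (1 / 3 - t) by rewrite mulr_ge0 // subr_ge0.
    have t3 : 0 <= t ^+ 3 by rewrite exprn_ge0 //; lra.
    by lra.
  have : 0 <= n2 * ((1 - 3 * t) * s ^+ 2 + s ^+ 3).
    rewrite mulr_ge0 ?(ltW n20) // addr_ge0 ?exprn_ge0 // mulr_ge0 ?sqr_ge0 //; lra.
  have m0 : 0 <= 1 + t by lra.
  have := ler_wpM2r (mulr_ge0 s0 m0) tE.
  by rewrite /kappa; move: n2 {n20 tsn tE} => n2; lra.
rewrite -(ler_pM2l n20) /damped mulrA -/n2.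
apply: le_trans (ler_wpM2r (sqr_ge0 _) kap) _.
rewrite -mulrA [X in _ <= X]mulrCA; apply: ler_wpM2l; first by rewrite exprn_ge0 //; lra.
rewrite -subr_ge0 (_ : _ - _ = (t * s) ^+ 2 * (3 * n2 - 2 * (t * s))); last by ring.
by rewrite mulr_ge0 ?sqr_ge0 //; lra.
Qed.


Lemma damped_mul_le t (s r : R) : 0 <= t <= 1 / 3 -> 0 <= s <= t -> 0 <= r <= t ->
  damped t s * damped t r * (1 - 2 * s * r) <= (root_cap * (1 - t) ^+ 2) ^+ 2.
Proof.
move=> /andP[t0 t3] st rt; have t01 : 0 <= t <= 1 by apply/andP; split; lra.
have [tl|/ltW tl] := leP t (4 / 25); first by apply: damped_mul_le_low; rewrite ?t0.
have K0 := damped_ge0 t01 st; have K1 := damped_ge0 t01 rt.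
have /andP[s0 s1] := st; have /andP[r0 r1] := rt.
apply: (@le_trans _ _ (damped t s * damped t r)).
  by apply: ler_piMr; [exact: mulr_ge0|rewrite gerBl !mulr_ge0].
by rewrite expr2; apply: ler_pM => //; apply: damped_le_mid; rewrite ?tl.
Qed.

Lemma two_two_normalized t D E D' E' : 0 <= t ->
  0 <= D <= 1 -> 0 <= E <= 1 -> 0 <= D' <= 1 -> 0 <= E' <= 1 ->
  t * (1 + D) * (1 + E') <= 1 -> t * (1 + D') * (1 + E) <= 1 ->
  block t D E * block t D' E' * cross t D E' * cross t D' E <= cap R.
Proof.
move=> t0 D01 E01 D01' E01' l1 l2.
have /andP[D0 D1] := D01; have /andP[E0 E1] := E01.
have /andP[D0' D1'] := D01'; have /andP[E0' E1'] := E01'.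
have t1 : t <= 1.
  apply: le_trans l1; rewrite -mulrA ler_peMr //.
  by apply: mulr_ege1; rewrite lerDl.
have t01 : 0 <= t <= 1 by rewrite t0.
set s := t * D * E; set s' := t * D' * E'.
have st x y : 0 <= x <= 1 -> 0 <= y <= 1 -> 0 <= t * x * y <= t.
  move=> /andP[x0 x1] /andP[y0 y1]; rewrite -mulrA !mulr_ge0 //=.
  by apply: ler_piMr => //; rewrite mulr_ile1.
have sst : 0 <= s <= t := st _ _ D01 E01; have sst' : 0 <= s' <= t := st _ _ D01' E01'.
have /andP[b0 b1] := block_le t01 D01 E01; have /andP[b0' b1'] := block_le t01 D01' E01'.
have /andP[c0 c1] := cross_le_amgm t01 D01 E01' l1.
have /andP[c0' c1'] := cross_le_amgm t01 D01' E01 l2.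
have bb0 := mulr_ge0 b0 b0'; have bb := ler_pM b0 b0' b1 b1'.
have k0 := kappa_ge0 t01 sst; have k0' := kappa_ge0 t01 sst'.
rewrite -mulrA -root_capX4.
have [t3|/ltW t3] := leP t (1 / 3); last first.
  have n0 : 0 <= 1 - t by lra.
  have kle x : 0 <= x <= t -> kappa t x <= (1 + t) ^+ 3.
    move=> /andP[x0 xt]; rewrite /kappa -addrA gerDl.
    have : 0 <= (3 * t - 1) * x * (1 + t - x) by rewrite !mulr_ge0 //; lra.
    have : 0 <= x ^+ 3 by rewrite exprn_ge0.
    by lra.
  have kk y : 0 <= kappa t y -> kappa t y <= (1 + t) ^+ 3 -> kappa t y ^+ 2 <= ((1 + t) ^+ 3) ^+ 2.
    by move=> y0 yle; rewrite lerXn2r ?nnegrE // (le_trans y0).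
  have := ler_pM bb0 (mulr_ge0 c0 c0')
    (le_trans bb (ler_pM (sqr_ge0 _) (sqr_ge0 _) (kk _ k0 (kle _ sst)) (kk _ k0' (kle _ sst'))))
    (ler_pM c0 c0' c1 c1').
  move/le_trans; apply.
  rewrite (_ : _ * _ = ((1 + t) ^+ 3 * (1 - t) ^+ 2) ^+ 4); last by ring.
  have m0 : 0 <= 1 + t by lra.
  by rewrite lerXn2r ?nnegrE ?root_cap_ge0 ?balanced_le // mulr_ge0 // exprn_ge0.
have t13 : 0 <= t <= 1 / 3 by rewrite t0.
have n0 : 0 < 1 - t by lra.
have n4 : 0 < (1 - t) ^+ 4 by rewrite exprn_gt0.
(* One factor [(1 - t)^4] for each of the two applications of [cross_le]. *)
rewrite -(ler_pM2r n4) -(ler_pM2r n4).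
set n2 := (1 - t) ^+ 2.
pose f x := n2 - t ^+ 2 * x ^+ 2.
have f0 x : 0 <= x <= 1 -> 0 <= f x.
  move=> /andP[x0 x1]; rewrite subr_ge0 /n2 -exprMn lerXn2r ?nnegrE ?mulr_ge0 //; first by lra.
  by apply: le_trans (ler_piMr t0 x1) _; lra.
have fM x y : f x * f y <= (n2 - t * (t * x * y)) ^+ 2.
  rewrite -subr_ge0 (_ : _ - _ = n2 * (t * (x - y)) ^+ 2); last by rewrite /f; ring.
  by rewrite mulr_ge0 ?sqr_ge0.
have damp x y : 0 <= x <= 1 -> 0 <= y <= 1 -> 0 <= 1 - 2 * (t * x * y) ^+ 2.
  move=> x01 y01; have /andP[p0 p1] := st _ _ x01 y01; nra.
have X1 := cross_le t13 D01 E01'; have X2 := cross_le t13 D01' E01.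
rewrite -!/n2 -!/(f _) in X1 X2.
have Y1 : 0 <= cross t D E' * (1 - t) ^+ 4 by rewrite mulr_ge0 // ltW.
have Y2 : 0 <= cross t D' E * (1 - t) ^+ 4 by rewrite mulr_ge0 // ltW.
have H := ler_pM bb0 (mulr_ge0 Y1 Y2) bb (ler_pM Y1 Y2 X1 X2).
have regroup (a b c d : R) : a * (b * c) * d * d = a * (b * d * (c * d)) by ring.
rewrite regroup.
apply: le_trans H _.
(* The cross blocks pair [D] with [E'] and [D'] with [E]; regrouping the factors [f] as in [block]
   yields bounds in [s] and [s']. *)
have ff : f D * f E * (f D' * f E') <= ((n2 - t * s) * (n2 - t * s')) ^+ 2.
  by rewrite exprMn; apply: ler_pM (fM D E) (fM D' E'); apply: mulr_ge0; apply: f0.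
have ff0 : 0 <= f D * f E * (f D' * f E') by apply: mulr_ge0; apply: mulr_ge0; apply: f0.
have ww : (1 - 2 * (t * D * E') ^+ 2) * (1 - 2 * (t * D' * E) ^+ 2) <= (1 - 2 * s * s') ^+ 2.
  rewrite -subr_ge0 (_ : _ - _ = 2 * (t * (D * E' - D' * E)) ^+ 2); last by rewrite /s /s'; ring.
  by rewrite mulr_ge0 ?sqr_ge0.
have ww0 : 0 <= (1 - 2 * (t * D * E') ^+ 2) * (1 - 2 * (t * D' * E) ^+ 2).
  by apply: mulr_ge0; apply: damp.
apply: (@le_trans _ _ ((damped t s * damped t s' * (1 - 2 * s * s')) ^+ 2)).
  have ff2 : (f D * f E * (f D' * f E')) ^+ 2 <= (((n2 - t * s) * (n2 - t * s')) ^+ 2) ^+ 2.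
    by rewrite lerXn2r ?nnegrE ?sqr_ge0.
  have := ler_wpM2l (mulr_ge0 (sqr_ge0 (kappa t s)) (sqr_ge0 (kappa t s')))
    (ler_pM (sqr_ge0 _) ww0 ff2 ww).
  by congr (_ <= _); rewrite /damped -/n2; ring.
rewrite (_ : root_cap ^+ 4 * _ * _ = ((root_cap * (1 - t) ^+ 2) ^+ 2) ^+ 2); last by ring.
rewrite lerXn2r ?nnegrE ?sqr_ge0 ?damped_mul_le //.
apply: mulr_ge0; first by apply: mulr_ge0; apply: damped_ge0.
by have /andP[? ?] := sst; have /andP[? ?] := sst'; nra.
Qed.
End TwoTwo.

(** * The three sign patterns for sorted vectors *)

Section Sorted.
Variable R : realFieldType.
Implicit Types a b : R.

Lemma half_diff_ratio (p q : R) : 0 <= q <= p ->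
  exists2 D, 0 <= D <= 1 & p = (p + q) / 2 * (1 + D) /\ q = (p + q) / 2 * (1 - D).
Proof.
move=> /andP[q0 qp]; have [S0|S0] := eqVneq (p + q) 0.
  by exists 0; rewrite ?lexx ?ler01 // S0; split; lra.
have Sp : 0 < p + q by rewrite lt_def S0 addr_ge0 // (le_trans q0).
exists ((p - q) / (p + q)); last by split; field.
rewrite divr_ge0 ?subr_ge0 ?(ltW Sp) //= ler_pdivrMr // mul1r; lra.
Qed.

Lemma same_sign_ge0 (x y : R) : 0 <= x * y -> 0 <= x + y -> 0 <= x /\ 0 <= y.
Proof.
move=> xy0 xy; have [x0|x0] := leP 0 x; have [y0|y0] := leP 0 y; split=> //; nra.
Qed.

Variables a1 a2 a3 a4 b1 b2 b3 b4 : R.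

Definition entries_prod : R :=
  (1 + a1 * b1) * (1 + a2 * b2) * (1 + a3 * b3) * (1 + a4 * b4)
  * (((1 + a1 * b1) * (1 + a1 * b2) * (1 + a1 * b3) * (1 + a1 * b4))
     * ((1 + a2 * b1) * (1 + a2 * b2) * (1 + a2 * b3) * (1 + a2 * b4))
     * ((1 + a3 * b1) * (1 + a3 * b2) * (1 + a3 * b3) * (1 + a3 * b4))
     * ((1 + a4 * b1) * (1 + a4 * b2) * (1 + a4 * b3) * (1 + a4 * b4))).

(** The factors become atoms, so that [ring] only reorders a product of twenty of them instead of
    expanding a polynomial of degree 40. *)
Ltac generalize_entries :=
  move: (1 + a1 * b1) (1 + a1 * b2) (1 + a1 * b3) (1 + a1 * b4)
        (1 + a2 * b1) (1 + a2 * b2) (1 + a2 * b3) (1 + a2 * b4)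
        (1 + a3 * b1) (1 + a3 * b2) (1 + a3 * b3) (1 + a3 * b4)
        (1 + a4 * b1) (1 + a4 * b2) (1 + a4 * b3) (1 + a4 * b4).

Lemma entries_two_two : a1 + a2 + a3 + a4 = 0 -> b1 + b2 + b3 + b4 = 0 ->
  0 <= a2 <= a1 -> a4 <= a3 <= 0 -> 0 <= b2 <= b1 -> b4 <= b3 <= 0 ->
  0 <= 1 + a1 * b4 -> 0 <= 1 + a4 * b1 -> entries_prod <= cap R.
Proof.
move=> sa sb a12 /andP[a43 a30] b12 /andP[b43 b30] e14 e41.
have [D D01 [a1E a2E]] := half_diff_ratio a12.
have [E E01 [b1E b2E]] := half_diff_ratio b12.
have a34 : 0 <= - a3 <= - a4 by rewrite oppr_ge0 a30 lerN2.
have b34 : 0 <= - b3 <= - b4 by rewrite oppr_ge0 b30 lerN2.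
have [D' D01' [a4E a3E]] := half_diff_ratio a34.
have [E' E01' [b4E b3E]] := half_diff_ratio b34.
set x := (a1 + a2) / 2 in a1E a2E; set y := (b1 + b2) / 2 in b1E b2E.
(* By the zero sums, the positive and negative pairs have the same half-sum in absolute value. *)
rewrite (_ : (- a4 - a3) / 2 = x) in a4E a3E; last by rewrite /x; lra.
rewrite (_ : (- b4 - b3) / 2 = y) in b4E b3E; last by rewrite /y; lra.
pose t := x * y.
have t0 : 0 <= t.
  case/andP: a12 => ? ?; case/andP: b12 => ? ?.
  by rewrite mulr_ge0 // divr_ge0 // addr_ge0 //; lra.
have pp p q u v : p = x * u -> q = y * v -> 1 + p * q = 1 + t * u * v.
  by move=> -> ->; rewrite /t; ring.
have pm p q u v : p = x * u -> - q = y * v -> 1 + p * q = 1 - t * u * v.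
  by move=> -> qE; rewrite -[q]opprK qE /t; ring.
have mp p q u v : - p = x * u -> q = y * v -> 1 + p * q = 1 - t * u * v.
  by move=> pE ->; rewrite -[p]opprK pE /t; ring.
have mm p q u v : - p = x * u -> - q = y * v -> 1 + p * q = 1 + t * u * v.
  by move=> pE qE; rewrite -[p]opprK -[q]opprK pE qE /t; ring.
have l1 : t * (1 + D) * (1 + E') <= 1.
  by rewrite -subr_ge0 -(pm _ _ _ _ a1E b4E).
have l2 : t * (1 + D') * (1 + E) <= 1.
  by rewrite -subr_ge0 -(mp _ _ _ _ a4E b1E).
apply: le_trans (two_two_normalized t0 D01 E01 D01' E01' l1 l2).
rewrite /block /cross.
rewrite -(pp _ _ _ _ a1E b1E) -(pp _ _ _ _ a1E b2E) -(pp _ _ _ _ a2E b1E) -(pp _ _ _ _ a2E b2E).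
rewrite -(mm _ _ _ _ a4E b4E) -(mm _ _ _ _ a4E b3E) -(mm _ _ _ _ a3E b4E) -(mm _ _ _ _ a3E b3E).
rewrite -(pm _ _ _ _ a1E b4E) -(pm _ _ _ _ a1E b3E) -(pm _ _ _ _ a2E b4E) -(pm _ _ _ _ a2E b3E).
rewrite -(mp _ _ _ _ a4E b1E) -(mp _ _ _ _ a4E b2E) -(mp _ _ _ _ a3E b1E) -(mp _ _ _ _ a3E b2E).
rewrite le_eqVlt; apply/orP; left; apply/eqP; rewrite /entries_prod.
by generalize_entries => *; ring.
Qed.

Lemma entries_one_three : a1 + a2 + a3 + a4 = 0 -> b1 + b2 + b3 + b4 = 0 ->
  a2 <= 0 -> a3 <= 0 -> a4 <= 0 -> b2 <= 0 -> b3 <= 0 -> b4 <= 0 ->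
  0 <= 1 + a1 * b2 -> 0 <= 1 + a1 * b3 -> 0 <= 1 + a1 * b4 ->
  0 <= 1 + a2 * b1 -> 0 <= 1 + a3 * b1 -> 0 <= 1 + a4 * b1 -> entries_prod <= cap R.
Proof.
rewrite -![_ <= 0]oppr_ge0 => sa sb a20 a30 a40 b20 b30 b40 e12 e13 e14 e21 e31 e41.
have a1E : - a2 + - a3 + - a4 = a1 by lra.
have b1E : - b2 + - b3 + - b4 = b1 by lra.
have neg (p q : R) : 1 - p * - q = 1 + p * q by ring.
have le1 (p q : R) : 0 <= 1 + p * q -> p * - q <= 1 by move=> ?; lra.
have := @three_one_le R (- a2) (- a3) (- a4) (- b2) (- b3) (- b4) a20 a30 a40 b20 b30 b40.
rewrite /= a1E b1E !mulrNN !neg [b1 * a2]mulrC [b1 * a3]mulrC [b1 * a4]mulrC.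
move=> H; apply: le_trans (H _ _ _ _ _ _); try by apply: le1; rewrite // mulrC.
rewrite le_eqVlt; apply/orP; left; apply/eqP; rewrite /entries_prod.
by generalize_entries => *; ring.
Qed.

Lemma entries_three_one : a1 + a2 + a3 + a4 = 0 -> b1 + b2 + b3 + b4 = 0 ->
  0 <= a1 -> 0 <= a2 -> 0 <= a3 -> 0 <= b1 -> 0 <= b2 -> 0 <= b3 ->
  0 <= 1 + a4 * b1 -> 0 <= 1 + a4 * b2 -> 0 <= 1 + a4 * b3 ->
  0 <= 1 + a1 * b4 -> 0 <= 1 + a2 * b4 -> 0 <= 1 + a3 * b4 -> entries_prod <= cap R.
Proof.
move=> sa sb a10 a20 a30 b10 b20 b30 e41 e42 e43 e14 e24 e34.
have a4E : a1 + a2 + a3 = - a4 by lra.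
have b4E : b1 + b2 + b3 = - b4 by lra.
have neg (p q : R) : 1 - - p * q = 1 + p * q by ring.
have le1 (p q : R) : 0 <= 1 + p * q -> - p * q <= 1 by move=> ?; lra.
have := @three_one_le R a1 a2 a3 b1 b2 b3 a10 a20 a30 b10 b20 b30.
rewrite /= a4E b4E !mulrNN !neg [b4 * a2]mulrC [b4 * a3]mulrC [b4 * a1]mulrC.
move=> H; apply: le_trans (H _ _ _ _ _ _); try by apply: le1; rewrite // mulrC.
rewrite le_eqVlt; apply/orP; left; apply/eqP; rewrite /entries_prod.
by generalize_entries => *; ring.
Qed.

(** Since [a_i b_i >= 0], the sign of [a_i + b_i] is shared by [a_i] and [b_i]. The extreme
    coordinates have known signs, so indices 2 and 3 decide the pattern. *)
Lemma entries_sorted : a1 + a2 + a3 + a4 = 0 -> b1 + b2 + b3 + b4 = 0 ->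
  a4 <= a3 -> a3 <= a2 -> a2 <= a1 -> b4 <= b3 -> b3 <= b2 -> b2 <= b1 ->
  0 <= a2 * b2 -> 0 <= a3 * b3 ->
  0 <= 1 + a1 * b2 -> 0 <= 1 + a1 * b3 -> 0 <= 1 + a1 * b4 ->
  0 <= 1 + a2 * b1 -> 0 <= 1 + a3 * b1 -> 0 <= 1 + a4 * b1 ->
  0 <= 1 + a4 * b2 -> 0 <= 1 + a4 * b3 -> 0 <= 1 + a2 * b4 -> 0 <= 1 + a3 * b4 ->
  entries_prod <= cap R.
Proof.
move=> sa sb a43 a32 a21 b43 b32 b21 ab2 ab3 e12 e13 e14 e21 e31 e41 e42 e43 e24 e34.
have [s2|s2] := leP 0 (a2 + b2); last first.
  have [] := @same_sign_ge0 (- a2) (- b2); rewrite ?mulrNN //; first by lra.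
  by move=> ? ?; apply: entries_one_three => //; lra.
have [a20 b20] := same_sign_ge0 ab2 s2.
have [s3|s3] := leP 0 (a3 + b3).
  have [a30 b30] := same_sign_ge0 ab3 s3.
  by apply: entries_three_one => //; lra.
have [] := @same_sign_ge0 (- a3) (- b3); rewrite ?mulrNN //; first by lra.
move=> a30 b30; apply: entries_two_two => //; apply/andP; split=> //; lra.
Qed.

End Sorted.

(** * Reduction to sorted vectors *)

Section Ordering.
Variable R : realFieldType.
Implicit Types a b c : 'I_4 -> R.

Definition entry_product a b : R :=
  (\prod_i (1 + a i * b i)) * \prod_i \prod_j (1 + a i * b j).

Lemma exists_decreasing_order n (c : 'I_n -> R) :
  exists s : {perm 'I_n}, forall i j : 'I_n, (i <= j)%N -> c (s j) <= c (s i).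
Proof.
pose e := [rel i j : 'I_n | c j <= c i]; pose l := sort e (enum 'I_n).
have e_total : total e by move=> i j; exact: le_total.
have e_trans : transitive e by move=> j i k /= ij jk; exact: le_trans jk ij.
have sl : size l = n by rewrite size_sort size_enum_ord.
have ul : uniq l by rewrite sort_uniq enum_uniq.
have inj : injective (fun i : 'I_n => nth i l i).
  move=> i j; rewrite (set_nth_default j) ?sl // => /eqP.
  by rewrite nth_uniq ?sl // => /eqP/val_inj.
exists (perm inj) => i j ij; rewrite !permE.
have -> : nth j l j = nth i l j by apply: set_nth_default; rewrite sl.
apply: (sorted_leq_nth e_trans _ i (sort_sorted e_total _)) => //; rewrite ?inE ?sl //.
by move=> k /=; exact: lexx.
Qed.

Lemma entry_product_perm (s : {perm 'I_4}) a b :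
  entry_product (a \o s) (b \o s) = entry_product a b.
Proof.
rewrite /entry_product [in RHS](reindex_inj (@perm_inj _ s)); congr (_ * _).
rewrite [in RHS](reindex_inj (@perm_inj _ s)); apply: eq_bigr => i _.
by rewrite [in RHS](reindex_inj (@perm_inj _ s)).
Qed.

Lemma entry_product_le a b : \sum_i a i = 0 -> \sum_i b i = 0 ->
  (forall i j, 0 <= 1 + a i * b j) -> (forall i, 0 <= a i * b i) ->
  (forall i j, 0 <= (a i - a j) * (b i - b j)) -> entry_product a b <= cap R.
Proof.
move=> sa sb e0 ab0 abs.
(* As [a] and [b] are ordered alike, sorting their sum sorts both at once, even in the presence of
   ties. *)
have [s cs] := exists_decreasing_order (fun i => a i + b i).
rewrite -(entry_product_perm s).
have asE : \sum_i a (s i) = 0 by rewrite -[RHS]sa [RHS](reindex_inj (@perm_inj _ s)).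
have bsE : \sum_i b (s i) = 0 by rewrite -[RHS]sb [RHS](reindex_inj (@perm_inj _ s)).
have sorted (i j : 'I_4) : (i <= j)%N -> a (s j) <= a (s i) /\ b (s j) <= b (s i).
  move=> /cs ij; have [] := same_sign_ge0 (abs (s i) (s j)); first by lra.
  by rewrite !subr_ge0.
pose i0 := @Ordinal 4 0 isT; pose i1 := @Ordinal 4 1 isT.
pose i2 := @Ordinal 4 2 isT; pose i3 := @Ordinal 4 3 isT.
have ordE (T : Type) (f : 'I_4 -> T) : [/\ f ord0 = f i0, f (lift ord0 ord0) = f i1,
    f (lift ord0 (lift ord0 ord0)) = f i2 & f (lift ord0 (lift ord0 (lift ord0 ord0))) = f i3].
  by split; congr f; apply: val_inj.
have sum4 (f : 'I_4 -> R) : \sum_i f i = f i0 + f i1 + f i2 + f i3.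
  by rewrite !big_ord_recl big_ord0; have [-> -> -> ->] := ordE _ f; rewrite addr0 !addrA.
have prod4 (f : 'I_4 -> R) : \prod_i f i = f i0 * f i1 * f i2 * f i3.
  by rewrite !big_ord_recl big_ord0; have [-> -> -> ->] := ordE _ f; rewrite mulr1 !mulrA.
rewrite !sum4 in asE bsE.
have [a10 b10] := sorted i0 i1 isT; have [a21 b21] := sorted i1 i2 isT.
have [a32 b32] := sorted i2 i3 isT.
apply: le_trans (entries_sorted asE bsE a32 a21 a10 b32 b21 b10 (ab0 _) (ab0 _)
  (e0 _ _) (e0 _ _) (e0 _ _) (e0 _ _) (e0 _ _) (e0 _ _) (e0 _ _) (e0 _ _) (e0 _ _) (e0 _ _)).
by rewrite /entry_product !prod4.
Qed.

End Ordering.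

(** * Scaling and the maximum of the likelihood *)

Section Model.
Variable R : realType.
Implicit Types (P : 'M[R]_4) (a b : 'I_4 -> R).

Lemma amgm4 (x : 'I_4 -> R) : (forall i, 0 <= x i) ->
  \prod_i (4 * x i) <= (\sum_i x i) ^+ 4 ?= iff [forall i, forall j, x i == x j].
Proof.
move=> x0; have := @leif_AGM_scaled R 'I_4 predT x; rewrite card_ord => H.
have {H} := H (fun i _ => mulrn_wge0 4 (x0 i)).
rewrite (eq_bigr (fun i => 4 * x i)) => [|i _]; last by rewrite mulr_natl.
by congr (_ <= _ ?= iff _); apply: eq_forallb => i; rewrite inE.
Qed.

Definition root_likelihood P : R := (\prod_i P i i) * \prod_i \prod_j P i j.

Lemma likelihoodE P : likelihood P = root_likelihood P ^+ 2.
Proof.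
have rowE i : P i i ^+ 4 * \prod_(j | j != i) P i j ^+ 2 = (P i i * \prod_j P i j) ^+ 2.
  by rewrite [in RHS](bigD1 i) //= prodrXl; ring.
rewrite /likelihood /root_likelihood -!big_split /=.
by rewrite (eq_bigr _ (fun i _ => rowE i)) prodrXl.
Qed.

Lemma root_likelihood_tr P : root_likelihood P^T = root_likelihood P.
Proof.
rewrite /root_likelihood; congr (_ * _); first by apply: eq_bigr => i _; rewrite mxE.
rewrite exchange_big; apply: eq_bigr => i _; apply: eq_bigr => j _; by rewrite mxE.
Qed.

Lemma root_likelihood_ge0 P : (forall i j, 0 <= P i j) -> 0 <= root_likelihood P.
Proof.
by move=> P0; rewrite mulr_ge0 // prodr_ge0 // => i _; rewrite prodr_ge0.
Qed.

Lemma rank2_model_tr P : rank2_model P -> rank2_model P^T.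
Proof.
move=> [P0 P1 rP]; split; [by move=> i j; rewrite mxE| |by rewrite mxrank_tr].
by rewrite exchange_big -P1; apply: eq_bigr => i _; apply: eq_bigr => j _; rewrite mxE.
Qed.

(** The exponent 5 counts the four entries of a row and its diagonal entry once more. *)
Lemma root_likelihood_scale_rows (c : 'I_4 -> R) P :
  root_likelihood (\matrix_(i, j) (c i * P i j)) = (\prod_i c i) ^+ 5 * root_likelihood P.
Proof.
set Q := \matrix_(i, j) _; have QE i j : Q i j = c i * P i j by rewrite mxE.
rewrite /root_likelihood.
have -> : \prod_i Q i i = (\prod_i c i) * \prod_i P i i.
  by rewrite -big_split; apply: eq_bigr => i _; rewrite QE.
have -> : \prod_i \prod_j Q i j = (\prod_i c i) ^+ 4 * \prod_i \prod_j P i j.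
  rewrite -prodrXl -big_split; apply: eq_bigr => i _.
  by rewrite (eq_bigr _ (fun j _ => QE i j)) big_split /= prodr_const card_ord.
by ring.
Qed.

Definition row_normalize P : 'M[R]_4 :=
  \matrix_(i, j) ((4 * \sum_k P i k)^-1 * P i j).

Lemma row_normalize_sum P i : \sum_k P i k != 0 -> \sum_j row_normalize P i j = 4^-1.
Proof.
move=> r0; rewrite (eq_bigr (fun j => (4 * \sum_k P i k)^-1 * P i j));
  last by move=> j _; rewrite mxE.
by rewrite -mulr_sumr invfM mulfVK.
Qed.

Lemma row_normalize_model P : rank2_model P -> (forall i, 0 < \sum_j P i j) ->
  rank2_model (row_normalize P).
Proof.
move=> [P0 _ rP] r0; split.
- by move=> i j; rewrite mxE mulr_ge0 // invr_ge0 mulr_ge0 // ltW.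
- rewrite (eq_bigr (fun=> 4^-1)); first by rewrite sumr_const card_ord; lra.
  by move=> i _; rewrite row_normalize_sum ?gt_eqF.
- rewrite (_ : row_normalize P = diag_mx (\row_i (4 * \sum_k P i k)^-1) *m P).
    exact: leq_trans (mxrankM_maxr _ _) rP.
  by apply/matrixP => i j; rewrite mul_diag_mx !mxE.
Qed.

Lemma root_likelihood_row_normalize P : (forall i, 0 < \sum_j P i j) ->
  root_likelihood P = (\prod_i (4 * \sum_j P i j)) ^+ 5 * root_likelihood (row_normalize P).
Proof.
move=> r0; rewrite root_likelihood_scale_rows mulrA -exprMn -big_split /=.
rewrite big1 ?expr1n ?mul1r // => i _; rewrite divff //.
by rewrite mulf_neq0 // gt_eqF.
Qed.

Lemma root_likelihood_row_normalize_ge P : rank2_model P -> (forall i, 0 < \sum_j P i j) ->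
  root_likelihood P <= root_likelihood (row_normalize P).
Proof.
move=> mP r0; have [P0 P1 rP] := mP.
rewrite [leLHS]root_likelihood_row_normalize //.
have [Q0 _ _] := row_normalize_model mP r0.
apply: ler_piMl; first exact: root_likelihood_ge0.
have /leifP := amgm4 (fun i => ltW (r0 i)).
have p0 : 0 <= \prod_i (4 * \sum_j P i j) by apply: prodr_ge0 => i _; rewrite mulr_ge0 ?ltW.
rewrite P1 expr1n => H; rewrite exprn_ile1 //.
by case: ifP H => _ => [/eqP ->|/ltW].
Qed.

(** Unless the row sums are equal, AM-GM is strict and normalisation strictly increases a positive
    likelihood. *)
Lemma row_sums_uniform P : rank2_model P -> 0 < root_likelihood P ->
  (forall i, 0 < \sum_j P i j) ->
  root_likelihood (row_normalize P) <= root_likelihood P -> forall i, \sum_j P i j = 4^-1.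
Proof.
move=> [P0 P1 rP] L0 r0 Lle i.
have /leifP := amgm4 (fun i => ltW (r0 i)); rewrite P1 expr1n.
case: ifP => [/forallP eqr _|_ plt].
  have : \sum_k \sum_j P k j = 1 by [].
  rewrite (eq_bigr (fun=> \sum_j P i j)); last first.
    by move=> k _; apply/eqP; have /forallP := eqr k; apply.
  by rewrite sumr_const card_ord => S; lra.
have p0 : 0 <= \prod_i (4 * \sum_j P i j) by apply: prodr_ge0 => k _; rewrite mulr_ge0 ?ltW.
have L0' : 0 < root_likelihood (row_normalize P).
  rewrite root_likelihood_row_normalize // in L0.
  rewrite -(pmulr_rgt0 _ (_ : 0 < (\prod_i (4 * \sum_j P i j)) ^+ 5)) // exprn_gt0 //.
  by rewrite prodr_gt0 // => k _; rewrite mulr_gt0.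
move: Lle; rewrite [leRHS]root_likelihood_row_normalize // leNgt gtr_pMl //.
by rewrite exprn_ilt1.
Qed.

End Model.

(** * A compact parametrisation and its maximum *)

Section Maximizer.
Variable R : realType.

Definition cube : set 'rV[R]_4 := [set v | forall i, `[(0 : R), 1]%classic (v ord0 i)].

Definition simplex : set 'rV[R]_4 := cube `&` [set v | \sum_i v ord0 i = 1].

Local Notation params := ('rV[R]_4 * ('rV[R]_4 * 'rV[R]_4))%type.

(* [(l, (u, v))]: the endpoints [u], [v] of the segment carrying the rows (scaled by 4),
   and the position [l i] of row [i] on it *)
Definition param_space : set params := cube `*` (simplex `*` simplex).

Definition mixture (z : params) : 'M[R]_4 :=
  \matrix_(i, j) (4^-1 * (z.2.2 ord0 j + z.1 ord0 i * (z.2.1 ord0 j - z.2.2 ord0 j))).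

Lemma cube_compact : compact cube.
Proof. exact: (@rV_compact R 4 (fun=> `[0, 1]%classic) (fun=> @segment_compact R 0 1)). Qed.

Lemma simplex_compact : compact simplex.
Proof.
apply: compact_closedI; first exact: cube_compact.
apply: (@preimage_closed _ _ (fun v : 'rV[R]_4 => \sum_i v ord0 i) [set 1]).
  by move=> v _; apply: continuous_big => [|i _]; [exact: add_continuous|exact: coord_continuous].
exact: closed_eq.
Qed.

Lemma mixture_continuous i j : continuous (fun z => mixture z i j).
Proof.
move=> z.
have -> : (fun z => mixture z i j) =
    (fun z : params => 4^-1 * (z.2.2 ord0 j + z.1 ord0 i * (z.2.1 ord0 j - z.2.2 ord0 j))).
  by apply/funext => y; rewrite mxE.
have c1 : {for z, continuous (fun z : params => z.1 ord0 i)}.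
  by apply: (@continuous_comp _ _ _ fst (fun v : 'rV[R]_4 => v ord0 i));
    [exact: cvg_fst|exact: coord_continuous].
have c2 : {for z, continuous (fun z : params => z.2.1 ord0 j)}.
  apply: (@continuous_comp _ _ _ (fst \o snd) (fun v : 'rV[R]_4 => v ord0 j));
    [|exact: coord_continuous].
  by apply: continuous_comp; [exact: cvg_snd|exact: cvg_fst].
have c3 : {for z, continuous (fun z : params => z.2.2 ord0 j)}.
  apply: (@continuous_comp _ _ _ (snd \o snd) (fun v : 'rV[R]_4 => v ord0 j));
    [|exact: coord_continuous].
  by apply: continuous_comp; [exact: cvg_snd|exact: cvg_snd].
apply: cvgM; first exact: cvg_cst.
by apply: cvgD; [exact: c3|apply: cvgM; [exact: c1|exact: cvgB c2 c3]].
Qed.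

Lemma mixture_maximum : exists2 z, param_space z &
  forall y, param_space y ->
  root_likelihood (mixture y) <= root_likelihood (mixture z).
Proof.
have cK : compact param_space.
  by apply: compact_setX; [exact: cube_compact|apply: compact_setX; exact: simplex_compact].
have K0 : param_space !=set0.
  have c0 : cube (const_mx 4^-1) by move=> i; rewrite mxE /= in_itv /=; apply/andP; split; lra.
  have s0 : simplex (const_mx 4^-1).
    split=> //=; rewrite (eq_bigr (fun=> 4^-1)) => [|i _]; last by rewrite mxE.
    by rewrite sumr_const card_ord; lra.
  by exists (const_mx 4^-1, (const_mx 4^-1, const_mx 4^-1)).
have cL : continuous (fun z => root_likelihood (mixture z)).
  move=> z; apply: cvgM; apply: continuous_big => [|i _];
    try exact: mul_continuous; first exact: mixture_continuous.
  apply: continuous_big => [|j _]; [exact: mul_continuous|exact: mixture_continuous].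
have [z zK zmax] := compact_EVT_max K0 cK (continuous_subspaceT cL).
by exists z => [|y yK]; [exact: set_mem|apply: zmax; exact: mem_set].
Qed.
End Maximizer.

(** * Structure of a maximum point, and the conclusion *)

Section Main.
Variable R : realType.
Implicit Types (P : 'M[R]_4) (a b : 'I_4 -> R).

Local Notation params := ('rV[R]_4 * ('rV[R]_4 * 'rV[R]_4))%type.

Lemma outer_sum_rank (p q r s : 'I_4 -> R) :
  (\rank (\matrix_(i < 4, j < 4) (p i * q j + r i * s j)%R) <= 2)%N.
Proof.
rewrite (_ : \matrix_(i, j) _ =
  (\matrix_(i < 4, k < 2) (if k == ord0 then p i else r i)) *m
  (\matrix_(k < 2, j < 4) (if k == ord0 then q j else s j))); first exact: mulmx_max_rank.
by apply/matrixP => i j; rewrite !mxE !big_ord_recl big_ord0 !mxE /= addr0.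
Qed.

Lemma mixture_row_sum (z : params) i : param_space z -> \sum_j mixture z i j = 4^-1.
Proof.
case: z => l [u v] /= [_ [[_ u1] [_ v1]]]; rewrite /= in u1 v1.
rewrite (eq_bigr (fun j => 4^-1 * (v ord0 j + l ord0 i * (u ord0 j - v ord0 j))));
  last by move=> j _; rewrite mxE.
by rewrite -mulr_sumr big_split /= -mulr_sumr sumrB u1 v1 subrr mulr0 addr0 mulr1.
Qed.

Lemma mixture_model (z : params) : param_space z -> rank2_model (mixture z).
Proof.
move: z => [l [u v]] zK; have [/= l01 [[u01 _] [v01 _]]] := zK.
have in01 (w : 'rV[R]_4) i : cube w -> 0 <= w ord0 i <= 1.
  by move=> /(_ i) /=; rewrite in_itv.
split.
- move=> i j; rewrite mxE /= mulr_ge0 ?invr_ge0 //.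
  have /andP[l0 l1] := in01 _ i l01; have /andP[u0 _] := in01 _ j u01.
  have /andP[v0 _] := in01 _ j v01; nra.
- rewrite (eq_bigr (fun=> 4^-1)); first by rewrite sumr_const card_ord; lra.
  by move=> i _; rewrite mixture_row_sum.
- rewrite (_ : mixture _ = \matrix_(i, j)
    (4^-1 * v ord0 j + l ord0 i * (4^-1 * (u ord0 j - v ord0 j)))).
    exact: (outer_sum_rank (fun=> 4^-1)).
  by apply/matrixP => i j; rewrite !mxE /=; ring.
Qed.

Lemma scaled_row_simplex P i : (forall j, 0 <= P i j) -> \sum_j P i j = 4^-1 ->
  simplex (\row_j (4 * P i j)).
Proof.
move=> P0 P1; split => [j /=|/=].
  rewrite mxE in_itv /= mulr_ge0 //=.
  have : P i j <= 4^-1 by rewrite -P1 (bigD1 j) //= lerDl sumr_ge0.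
  by lra.
rewrite (eq_bigr (fun j => 4 * P i j)) => [|j _]; last by rewrite mxE.
by rewrite -mulr_sumr P1; lra.
Qed.

(* Two distinct rows with equal sums are independent, so by the rank condition
   all rows lie on the line through them; the extreme rows on it span a segment. *)
Lemma row_uniform_mixture P : rank2_model P -> (forall i, \sum_j P i j = 4^-1) ->
  exists2 z : params, param_space z & P = mixture z.
Proof.
move=> [P0 _ rP] P1; have simp i := scaled_row_simplex (P0 i) (P1 i).
have [/existsP[k /existsP[l kl]]|] := boolP [exists k, [exists l, row k P != row l P]]; last first.
  (* All rows coincide: the segment degenerates to a point. *)
  move=> /existsPn same; exists (0, (\row_j (4 * P ord0 j), \row_j (4 * P ord0 j))).
    by split=> //= i; rewrite mxE /= in_itv /= lexx ler01.
  apply/matrixP => i j; rewrite !mxE /= mul0r addr0 mulKf ?pnatr_eq0 //.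
  have /existsPn/(_ ord0)/negPn/eqP/rowP/(_ j) := same i.
  by rewrite !mxE.
have rowsum i (c : R) : \sum_j c * P i j = c / 4 by rewrite -mulr_sumr P1.
have nkl : ~~ (row l P <= row k P)%MS.
  apply/negP => /sub_rVP[c lE]; case/eqP: kl.
  have c1 : c = 1.
    have : \sum_j P l j = \sum_j c * P k j.
      by apply: eq_bigr => j _; move/rowP/(_ j): lE; rewrite !mxE.
    by rewrite rowsum P1; lra.
  by rewrite lE c1 scale1r.
have k0 : row k P != 0.
  apply/eqP => /rowP kE; have := P1 k.
  rewrite big1 => [|j _]; first by lra.
  by have := kE j; rewrite !mxE.
pose A := col_mx (row k P) (row l P).
have AP : (A <= P)%MS by rewrite col_mx_sub !row_sub.
have rA : (2 <= \rank A)%N.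
  have kA : (row k P <= A)%MS by have := submx_refl A; rewrite col_mx_sub => /andP[].
  have := mxrank_leqif_sup kA; rewrite rank_rV k0 => /ltn_leqif ->.
  apply: contra nkl => /(submx_trans _); apply.
  by have := submx_refl A; rewrite col_mx_sub => /andP[].
have PA : (P <= A)%MS by rewrite -(geq_leqif (mxrank_leqif_sup AP)) (leq_trans rP).
have line i : exists mu : R, forall j, P i j = P l j + mu * (P k j - P l j).
  have /submxP[D DE] := submx_trans (row_sub i P) PA.
  rewrite -[D]hsubmxK mul_row_col in DE.
  set x := lsubmx D ord0 ord0; set y := rsubmx D ord0 ord0.
  have PE j : P i j = x * P k j + y * P l j.
    move/rowP/(_ j): DE; rewrite mxE => ->.
    by rewrite mxE; congr (_ + _); rewrite mxE big_ord1; congr (_ * _); rewrite mxE.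
  (* Equal row sums turn the linear combination into an affine one. *)
  have xy : x + y = 1.
    have := P1 i; rewrite (eq_bigr _ (fun j _ => PE j)) big_split /= !rowsum; lra.
  by exists x => j; rewrite PE (_ : y = 1 - x); [ring|lra].
have [mu muE] := fin_all_exists line.
have [imax _ imaxP] := @arg_maxP _ _ _ k predT mu isT.
have [imin _ iminP] := @arg_minP _ _ _ k predT mu isT.
have le_max i : mu i <= mu imax by exact: imaxP.
have min_le i : mu imin <= mu i by exact: iminP.
have lt : mu imin < mu imax.
  rewrite lt_neqAle le_max andbT; apply/eqP => eqm; case/eqP: kl.
  have const i : mu i = mu imax.
    by apply/eqP; rewrite eq_le le_max -eqm min_le.
  by apply/rowP => j; rewrite !mxE; have := muE k j; have := muE l j; rewrite !const; lra.
have dlt : mu imax - mu imin != 0 by rewrite subr_eq0 gt_eqF.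
(* Positions are rescaled so that the extreme rows sit at 0 and 1. *)
exists (\row_i ((mu i - mu imin) / (mu imax - mu imin)),
        (\row_j (4 * P imax j), \row_j (4 * P imin j))).
  split=> //= i; rewrite mxE /= in_itv /= divr_ge0 ?subr_ge0 ?(ltW lt) //=.
  by rewrite ler_pdivrMr ?subr_gt0 // mul1r lerD2r.
apply/matrixP => i j; rewrite !mxE /= (muE i) (muE imax) (muE imin); field.
by rewrite dlt.
Qed.

Lemma root_likelihood_maximum : exists2 z : params, param_space z &
  forall P, rank2_model P -> root_likelihood P <= root_likelihood (mixture z).
Proof.
have [z zK zmax] := mixture_maximum R; exists z => // P mP.
have [P0 _ _] := mP; have [Z0 _ _] := mixture_model zK.
have [/forallP r0|/forallPn[i]] := boolP [forall i, 0 < \sum_j P i j].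
  apply: le_trans (root_likelihood_row_normalize_ge mP r0) _.
  have [y yK ->] := row_uniform_mixture (row_normalize_model mP r0)
    (fun i => row_normalize_sum (lt0r_neq0 (r0 i))).
  exact: zmax.
(* A row of sum zero vanishes, and then so does the likelihood. *)
rewrite lt_def sumr_ge0 // andbT negbK psumr_eq0 // => /allP /(_ i).
rewrite mem_index_enum => /(_ isT) /eqP Pii.
by rewrite /root_likelihood (bigD1 i) //= Pii !mul0r root_likelihood_ge0.
Qed.

Definition deviation a b : 'M[R]_4 := \matrix_(i, j) (16^-1 * (1 + a i * b j)).

Lemma deviation_model a b : \sum_j b j = 0 -> (forall i j, 0 <= 1 + a i * b j) ->
  rank2_model (deviation a b).
Proof.
move=> b0 e0; split.
- by move=> i j; rewrite mxE mulr_ge0 // invr_ge0.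
- rewrite (eq_bigr (fun=> 4^-1)); first by rewrite sumr_const card_ord; lra.
  move=> i _; rewrite (eq_bigr (fun j => 16^-1 * (1 + a i * b j))); last by move=> j _; rewrite mxE.
  by rewrite -mulr_sumr big_split /= -mulr_sumr b0 mulr0 addr0 sumr_const card_ord; lra.
- rewrite (_ : deviation _ _ = \matrix_(i, j) (16^-1 * 1 + 16^-1 * a i * b j)).
    exact: (outer_sum_rank (fun=> 16^-1) (fun=> 1) (fun i => 16^-1 * a i) b).
  by apply/matrixP => i j; rewrite !mxE; ring.
Qed.

Lemma root_likelihood_deviation a b :
  root_likelihood (deviation a b) = 16^-1 ^+ 20 * entry_product a b.
Proof.
have E i j : deviation a b i j = 16^-1 * (1 + a i * b j) by rewrite mxE.
rewrite /root_likelihood /entry_product (eq_bigr _ (fun i _ => E i i)).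
have -> : \prod_i \prod_j deviation a b i j = 16^-1 ^+ 16 * \prod_i \prod_j (1 + a i * b j).
  rewrite (eq_bigr (fun i => 16^-1 ^+ 4 * \prod_j (1 + a i * b j))).
    by rewrite big_split /= prodr_const card_ord -exprM.
  by move=> i _; rewrite (eq_bigr _ (fun j _ => E i j)) big_split /= prodr_const card_ord.
by rewrite big_split /= prodr_const card_ord mulrACA -exprD.
Qed.

Lemma root_likelihood_entry_neq0 P : root_likelihood P != 0 -> forall i j, P i j != 0.
Proof.
rewrite mulf_eq0 negb_or => /andP[_] /prodf_neq0 rows i j.
by have /prodf_neq0/(_ j isT) := rows i isT.
Qed.

(* Replacing [a i] by 0 turns the factors of row [i] into 1, while the product of
   the entries of that row, whose mean is 1, is at most 1. *)
Lemma maximal_same_sign a b : \sum_j b j = 0 -> (forall i j, 0 < 1 + a i * b j) ->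
  (forall a', (forall i j, 0 <= 1 + a' i * b j) -> entry_product a' b <= entry_product a b) ->
  forall i, 0 <= a i * b i.
Proof.
move=> b0 e0 amax i; pose a' k := if k == i then 0 else a k.
pose row (c : 'I_4 -> R) k := (1 + c k * b k) * \prod_j (1 + c k * b j).
have rowE c : entry_product c b = \prod_k row c k by rewrite big_split.
have row_gt0 k : 0 < row a k by rewrite mulr_gt0 // prodr_gt0.
have row_i : row a' i = 1.
  rewrite /row /a' eqxx mul0r addr0 mul1r big1 // => j _; by rewrite mul0r addr0.
have row_k k : k != i -> row a' k = row a k by rewrite /row /a' => /negbTE ->.
have e' k j : 0 <= 1 + a' k * b j.
  by rewrite /a'; case: eqP => _; [rewrite mul0r addr0|exact: ltW].
have := amax a' e'; rewrite !rowE (bigD1 i) //= [leRHS](bigD1 i) //= row_i (eq_bigr _ row_k).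
rewrite ler_pM2r ?prodr_gt0 // => row_ge1.
have row_le1 : \prod_j (1 + a i * b j) <= 1.
  have x0 j : 0 <= (1 + a i * b j) / 4 by rewrite divr_ge0 // ltW.
  have [+ _] := amgm4 x0.
  rewrite (eq_bigr (fun j => 1 + a i * b j)); last by move=> j _; field.
  move=> /le_trans; apply; rewrite -mulr_suml big_split /= -mulr_sumr b0 mulr0 addr0.
  by rewrite sumr_const card_ord (_ : _ / 4 = 1) ?expr1n //; lra.
have : 1 <= 1 + a i * b i by apply: le_trans row_ge1 _; rewrite /row ler_piMr // ltW.
by lra.
Qed.

(** Exchanging [a i] and [a j] permutes the full product and alters only two diagonal factors, by
    [(1 + a_i b_i)(1 + a_j b_j) - (1 + a_j b_i)(1 + a_i b_j) = (a_i - a_j)(b_i - b_j)]. *)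
Lemma maximal_same_order a b : (forall i j, 0 < 1 + a i * b j) ->
  (forall a', (forall i j, 0 <= 1 + a' i * b j) -> entry_product a' b <= entry_product a b) ->
  forall i j, 0 <= (a i - a j) * (b i - b j).
Proof.
move=> e0 amax i j; have [->|ij] := eqVneq i j; first by rewrite !subrr mul0r.
have := amax (a \o tperm i j) (fun k l => ltW (e0 _ _)); rewrite /entry_product.
have -> : \prod_k \prod_l (1 + (a \o tperm i j) k * b l) = \prod_k \prod_l (1 + a k * b l).
  by rewrite [RHS](reindex_inj (@perm_inj _ (tperm i j))).
rewrite ler_pM2r; last by rewrite prodr_gt0 // => k _; rewrite prodr_gt0.
have ji : j != i by rewrite eq_sym.
rewrite (bigD1 i) //= (bigD1 j) //= [leRHS](bigD1 i) //= [X in _ <= _ * X](bigD1 j) //=.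
rewrite tpermL tpermR (eq_bigr (fun k => 1 + a k * b k)); last first.
  by move=> k /andP[ki kj]; rewrite tpermD // eq_sym.
rewrite !mulrA ler_pM2r ?prodr_gt0 // => H.
by move: H; rewrite -subr_ge0; congr (_ <= _); ring.
Qed.

Lemma root_likelihood_le P : rank2_model P -> root_likelihood P <= 16^-1 ^+ 20 * cap R.
Proof.
move=> mP; have [z zK zmax] := root_likelihood_maximum.
apply: le_trans (zmax P mP) _; have mZ := mixture_model zK; have [Z0 _ _] := mZ.
have c16 : 0 < 16^-1 ^+ 20 :> R by rewrite exprn_gt0 // invr_gt0.
have L0 : 0 < root_likelihood (mixture z).
  (* The uniform matrix shows that the maximum is positive. *)
  have /zmax : rank2_model (deviation (fun=> 0) (fun=> 0)).
    by apply: deviation_model => [|i j]; rewrite ?big1 // mul0r addr0.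
  apply: lt_le_trans; rewrite root_likelihood_deviation mulr_gt0 // mulr_gt0 //.
    by rewrite prodr_gt0 // => i _; rewrite mul0r addr0.
  by rewrite prodr_gt0 // => i _; rewrite prodr_gt0 // => j _; rewrite mul0r addr0.
have Zpos i j : 0 < mixture z i j by rewrite lt_def Z0 root_likelihood_entry_neq0 ?gt_eqF.
(* Rows of a mixture are uniform by construction; for the columns, maximality is applied to the
   transpose. *)
have col j : \sum_i mixture z i j = 4^-1.
  have c0 i : 0 < \sum_k (mixture z)^T i k.
    by rewrite (bigD1 i) //= mxE ltr_wpDr // sumr_ge0 // => k _; rewrite mxE.
  have Lle : root_likelihood (row_normalize (mixture z)^T) <= root_likelihood (mixture z)^T.
    rewrite root_likelihood_tr; apply: zmax; apply: row_normalize_model => //.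
    exact: rank2_model_tr.
  rewrite -(row_sums_uniform (rank2_model_tr mZ) _ c0 Lle j) ?root_likelihood_tr //.
  by apply: eq_bigr => i _; rewrite [RHS]mxE.
move: z zK zmax mZ Z0 L0 Zpos col => [l [u v]] zK zmax mZ Z0 L0 Zpos col.
(* Centring [l] makes [a] sum to zero; the uniform column sums then turn the constant part of 16
   times the entry into 1. *)
pose a i := 4 * l ord0 i - \sum_k l ord0 k; pose b j := u ord0 j - v ord0 j.
have ZE : mixture (l, (u, v)) = deviation a b.
  have colE j : 4 * v ord0 j + (\sum_k l ord0 k) * b j = 1.
    have := col j; rewrite (eq_bigr (fun i => 4^-1 * (v ord0 j + l ord0 i * b j))); last first.
      by move=> i _; rewrite mxE.
    by rewrite -mulr_sumr big_split /= -mulr_suml sumr_const card_ord; lra.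
  apply/matrixP => i j; rewrite !mxE /= -/(b j) /a; have := colE j.
  by move: (\sum_k l ord0 k) (b j) => s x; lra.
have b0 : \sum_j b j = 0.
  by have [_ [[_ /= u1] [_ /= v1]]] := zK; rewrite sumrB u1 v1 subrr.
have a0 : \sum_i a i = 0 by rewrite sumrB -mulr_sumr sumr_const card_ord; ring.
have e0 i j : 0 < 1 + a i * b j.
  by have := Zpos i j; rewrite ZE mxE pmulr_rgt0 // invr_gt0.
(* The competitors keep [b] fixed; as [b] sums to zero, their total mass remains 1. *)
have amax a' : (forall i j, 0 <= 1 + a' i * b j) -> entry_product a' b <= entry_product a b.
  move=> e'; have := zmax _ (deviation_model b0 e').
  by rewrite ZE !root_likelihood_deviation ler_pM2l.
rewrite ZE root_likelihood_deviation ler_pM2l //.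
apply: entry_product_le => // [i j|i|i j]; first exact: ltW.
- exact: maximal_same_sign amax i.
- exact: maximal_same_order amax i j.
Qed.

(* The scaling freedom (a, b) -> (c a, b / c) avoids the irrational choice a = b. *)
Definition half_sign (i : 'I_4) : R := if (i < 2)%N then 1 else -1.

Lemma Pstar_deviation : Pstar R = deviation (fun i => half_sign i / 5) half_sign.
Proof.
apply/matrixP => i j; rewrite !mxE /half_sign.
by case: i => [[|[|[|[|i]]]] //= ?]; case: j => [[|[|[|[|j]]]] //= ?]; field.
Qed.

Lemma entry_product_Pstar : entry_product (fun i => half_sign i / 5) half_sign = cap R.
Proof.
by rewrite /entry_product !big_ord_recl !big_ord0 /half_sign /= /cap; field.
Qed.

End Main.

Theorem mainTheorem1 (R : realType) :
  rank2_model (Pstar R) /\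
  (forall P : 'M[R]_4, rank2_model P -> likelihood P <= likelihood (Pstar R)).
Proof.
have LE := root_likelihood_deviation (fun i => half_sign R i / 5) (half_sign R).
rewrite entry_product_Pstar -Pstar_deviation in LE.
have mPstar : rank2_model (Pstar R).
  rewrite Pstar_deviation; apply: deviation_model.
    by rewrite !big_ord_recl big_ord0 /half_sign /=; ring.
  by move=> i j; rewrite /half_sign; case: ifP; case: ifP; lra.
split=> // P mP; have [P0 _ _] := mP; have [Q0 _ _] := mPstar.
have L0 := root_likelihood_ge0 P0; have L1 := root_likelihood_ge0 Q0.
by rewrite !likelihoodE lerXn2r ?nnegrE //= LE root_likelihood_le.
Qed.
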